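(* For a fixed signature $\Sigma$, the finiteness problem is polynomial time decidable: there is an algorithm which, given a finite set $\Gamma$ of ground term equations over $\Sigma$, decides in time polynomial in $|\Gamma|$ whether the algebra $\mathcal{F}_\Gamma$ is finite.
   Context: $\Sigma$ is a finite functional signature having function symbols (of positive arity) and constant symbols. $\mathcal{F}$ is the algebra of all ground terms (terms without variables) over $\Sigma$, with operations interpreted by term formation. A ground term equation is an expression $p=q$ with $p,q$ ground terms. For a finite set $\Gamma$ of such equations, $\sim_\Gamma$ is the smallest congruence on $\mathcal{F}$ containing all pairs $(p,q)$ with $p=q$ in $\Gamma$ (equivalently, $p\sim_\Gamma q$ iff $\Gamma\vdash p=q$), and $\mathcal{F}_\Gamma=\mathcal{F}/{\sim_\Gamma}$. The size $|t|$ of a ground term is the number of nodes of its syntax tree, and $|\Gamma|=\sum_{(p=q)\in\Gamma}(|p|+|q|)$. *)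

(* Defs.v *)
From Stdlib Require List.
From mathcomp Require Import all_boot.
From mathcomp Require Import boolp classical_sets functions cardinality.
Set Implicit Arguments.
Unset Strict Implicit.
Unset Printing Implicit Defensive.

Local Open Scope classical_set_scope.

(* Constants are the symbols of arity 0. *)
Record signature := Signature {
  symbol :> finType;
  arity : symbol -> nat
}.

Inductive term (S : signature) : Type :=
  App (f : S) of {ffun 'I_(arity f) -> term S}.

Section Terms.
Variable S : signature.
Implicit Types (p q t : term S) (G : seq (term S * term S)).

Fixpoint tsize t : nat :=
  let: App f a := t in (\sum_(i < arity f) tsize (a i)).+1.

Definition eqs_size G : nat := \sum_(e <- G) (tsize e.1 + tsize e.2).

Record is_congruence (r : term S -> term S -> Prop) : Prop := IsCongruence {
  congr_refl : forall t, r t t;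
  congr_sym : forall t u, r t u -> r u t;
  congr_trans : forall t u v, r t u -> r u v -> r t v;
  congr_App : forall (f : S) (a b : {ffun 'I_(arity f) -> term S}),
    (forall i, r (a i) (b i)) -> r (App a) (App b)
}.

(* List.In because term S carries no eqType structure. *)
Definition eqv G p q : Prop :=
  forall r : term S -> term S -> Prop, is_congruence r ->
    (forall u v, List.In (u, v) G -> r u v) -> r p q.

Definition eqv_class G t : set (term S) := [set u | eqv G t u].

(* The underlying set of the quotient algebra, as a set of classes. *)
Definition quotient_carrier G : set (set (term S)) := range (eqv_class G).

End Terms.

(* Input alphabet: the symbols of the signature and two punctuation marks. *)
Definition token (S : signature) : finType := (S + bool)%type.
Definition sym_tok (S : signature) (f : S) : token S := inl f.
Definition eq_tok (S : signature) : token S := inr true.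
Definition end_tok (S : signature) : token S := inr false.

(* Terms are written in Polish (prefix) notation. *)
Fixpoint term_word (S : signature) (t : term S) : seq (token S) :=
  let: App f a := t in
  sym_tok f :: flatten [seq term_word (a i) | i <- enum 'I_(arity f)].

Definition eqs_word (S : signature) (G : seq (term S * term S)) :
    seq (token S) :=
  flatten [seq term_word e.1 ++ eq_tok S :: rcons (term_word e.2) (end_tok S)
          | e <- G].

Inductive move := MoveLeft | Stay | MoveRight.

(* Cells of a machine with input alphabet I and auxiliary work alphabet W;
   None is the blank. *)
Definition cell (I W : finType) : finType := option (I + W)%type.

(* Deterministic multi-tape Turing machines.  The answer of a state is
   Some true if it is accepting, Some false if it is rejecting, and None if it
   is not a halting state. *)
Record machine (I : finType) := Machine {
  work : finType;
  state : finType;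
  ntapes : nat; (* number of tapes besides the input tape *)
  start : state;
  answer : state -> option bool;
  delta : state -> {ffun 'I_ntapes.+1 -> cell I work} ->
          state * {ffun 'I_ntapes.+1 -> cell I work * move}
}.

(* A two-way infinite tape (l, r): l lists the cells strictly left of the head,
   nearest first, and r the cells from the head rightwards; all the cells
   beyond these lists are blank. *)
Definition tape (I W : finType) : Type := seq (cell I W) * seq (cell I W).

Definition read (I W : finType) (t : tape I W) : cell I W := head None t.2.

Definition write_move (I W : finType) (t : tape I W) (x : cell I W * move) :
    tape I W :=
  let: (l, r) := t in
  let: (c, m) := x in
  match m with
  | MoveLeft => (behead l, head None l :: c :: behead r)
  | Stay => (l, c :: behead r)
  | MoveRight => (c :: l, behead r)
  end.

Section Run.
Variables (I : finType) (M : machine I).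

Definition config : Type :=
  state M * {ffun 'I_(ntapes M).+1 -> tape I (work M)}.

Definition initial (w : seq I) : config :=
  (start M,
   [ffun i => ([::], if i == ord0 then [seq Some (inl a) | a <- w] else [::])]).

(* Halting configurations are fixed points, so that the answer after n steps is
   the answer of any run that halts within n steps. *)
Definition step (x : config) : config :=
  let: (s, ts) := x in
  if answer s is Some _ then x else
  let: (s', act) := delta s [ffun i => read (ts i)] in
  (s', [ffun i => write_move (ts i) (act i)]).

Definition answer_within (n : nat) (w : seq I) : option bool :=
  answer (iter n step (initial w)).1.

End Run.

(* The problem P on instances x : X, presented to the machine as the words
   enc x and measured by the size sz, is decidable in polynomial time. *)
Definition polytime_decidable (X : Type) (I : finType) (enc : X -> seq I)
    (sz : X -> nat) (P : X -> Prop) : Prop :=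
  exists (M : machine I) (c d : nat), forall x : X, exists b : bool,
    answer_within M (c * sz x ^ d + c) (enc x) = Some b /\ (b <-> P x).

(* Main.v *)
(* Let T be the set of subterm occurrences of the equations and K the congruence
   closure of the equations on T.  Evaluating terms bottom-up in the partial
   algebra T/K, the terms that have no value form an absolutely free extension,
   so K is the restriction of ~ to T, and if some symbol g has positive arity
   then the quotient is finite iff T/K is total: for every f and all a_i in T
   there is an occurrence f(b) in T with b_i K a_i.  Otherwise a valueless term
   f(a) exists, and f(a), g(f(a), ..., f(a)), ... are pairwise inequivalent.

   An occurrence is a position of the input word.  A Turing machine computes, by
   saturation of a table indexed by pairs of positions, the relations "positions
   x to y hold m consecutive terms", "the first j arguments at x and y are
   congruent" and K itself; totality is then tested by nested loops over
   positions, one per argument of f. *)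

Require Import Defs.
From mathcomp Require Import all_boot.
From mathcomp Require Import boolp classical_sets functions cardinality.
From mathcomp Require Import zify.
Set Implicit Arguments.
Unset Strict Implicit.
Unset Printing Implicit Defensive.

(** * Composable machine fragments *)

(** Most of the work lies in obtaining an actual Turing machine with a polynomial bound. Between the
    machine and the mathematics stands a small language whose only loop is universal quantification
    over word positions. Compilation and running time are treated once, by induction on programs;
    afterwards only evaluation matters. Since the language has no unbounded loop, saturation cannot
    stop upon reaching a fixed point. A fixed quadratic number of passes is run instead, which is
    enough because facts are only ever added and the table has quadratically many of them. The
    signature is fixed, so its largest arity bounds the number of relation names and of tapes; the
    degree of the polynomial grows with it. Counting consecutive terms replaces a parser with a
    stack: it is how the arguments of an occurrence are located in prefix notation. If all symbols
    are constants, totality is the wrong criterion: a constant absent from the equations has no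
    value, yet the quotient is finite. This case is settled separately. *)

Section Fragments.
Variables (I W : finType) (nt : nat).
Notation tp := 'I_nt.+1.
Notation reads := {ffun tp -> cell I W}.
Notation acts := {ffun tp -> cell I W * move}.
Notation tapes := {ffun tp -> tape I W}.

(* A piece of control flow that leaves through one of two exits. *)
Record frag := Frag {
  pts : finType;
  entry : pts;
  next : pts -> reads -> (pts + bool) * acts
}.

Definition rd (ts : tapes) : reads := [ffun i => read (ts i)].
Definition act (a : acts) (ts : tapes) : tapes :=
  [ffun i => write_move (ts i) (a i)].

Inductive runs (m : frag) : pts m -> tapes -> nat -> bool -> tapes -> Prop :=
| RunsExit s ts b a : next s (rd ts) = (inr b, a) -> runs s ts 1 b (act a ts)
| RunsStep s s' ts ts' k b a : next s (rd ts) = (inl s', a) ->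
    runs s' (act a ts) k b ts' -> runs s ts k.+1 b ts'.

Definition prim (g : reads -> bool * acts) : frag :=
  @Frag unit tt (fun _ r => (inr (g r).1, (g r).2)).

Definition ite (m p q : frag) : frag :=
  @Frag (pts m + (pts p + pts q))%type (inl (entry m)) (fun s r =>
    match s with
    | inl s => let: (o, a) := next s r in
        (inl match o with
             | inl s' => inl s'
             | inr true => inr (inl (entry p))
             | inr false => inr (inr (entry q))
             end, a)
    | inr (inl s) => let: (o, a) := next s r in
        (match o with inl s' => inl (inr (inl s')) | inr b => inr b end, a)
    | inr (inr s) => let: (o, a) := next s r in
        (match o with inl s' => inl (inr (inr s')) | inr b => inr b end, a)
    end).

Definition loop (m : frag) : frag :=
  @Frag (pts m) (entry m) (fun s r =>
    let: (o, a) := next s r in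
    (match o with
     | inl s' => inl s'
     | inr true => inl (entry m)
     | inr false => inr true
     end, a)).

Lemma runs_prim g ts :
  runs (entry (prim g)) ts 1 (g (rd ts)).1 (act (g (rd ts)).2 ts).
Proof. exact: RunsExit. Qed.

Lemma runs_ite m p q s ts k b ts' k' b' ts'' :
  runs s ts k b ts' ->
  (if b then runs (entry p) ts' k' b' ts'' else runs (entry q) ts' k' b' ts'') ->
  @runs (ite m p q) (inl s) ts (k + k') b' ts''.
Proof.
elim=> {s ts k b ts'} [s ts b a E|s s' ts ts' k b a E _ IH] H.
- case: b E H => E H.
  + apply: (@RunsStep (ite m p q) _ (inr (inl (entry p)))); first by rewrite /= E.
    elim: H => [s1 ts1 b1 a1 E1|s1 s2 ts1 ts2 k1 b1 a1 E1 _ IH1].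
    * by apply: RunsExit; rewrite /= E1.
    * by apply: RunsStep IH1; rewrite /= E1.
  + apply: (@RunsStep (ite m p q) _ (inr (inr (entry q)))); first by rewrite /= E.
    elim: H => [s1 ts1 b1 a1 E1|s1 s2 ts1 ts2 k1 b1 a1 E1 _ IH1].
    * by apply: RunsExit; rewrite /= E1.
    * by apply: RunsStep IH1; rewrite /= E1.
- by rewrite addSn; apply: RunsStep (IH H); rewrite /= E.
Qed.

Lemma runs_loop_exit m s ts k ts' :
  @runs m s ts k false ts' -> @runs (loop m) s ts k true ts'.
Proof.
suff H b : @runs m s ts k b ts' -> ~~ b -> @runs (loop m) s ts k true ts' by move/H; apply.
elim=> {s ts k b ts'} [s ts b a E /negPf eb|s s' ts ts' k b a E _ IH /IH].
- by apply: RunsExit; rewrite /= E eb.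
- by apply: RunsStep; rewrite /= E.
Qed.

Lemma runs_loop_again m s ts k ts' k' ts'' :
  @runs m s ts k true ts' -> @runs (loop m) (entry m) ts' k' true ts'' ->
  @runs (loop m) s ts (k + k') true ts''.
Proof.
suff H b : @runs m s ts k b ts' -> b -> @runs (loop m) (entry m) ts' k' true ts'' ->
    @runs (loop m) s ts (k + k') true ts'' by move/H; apply.
elim=> {s ts k b ts'} [s ts b a E eb|s s' ts ts' k b a E _ IH eb /(IH eb)].
- by apply: RunsStep; rewrite /= E eb.
- by rewrite addSn; apply: RunsStep; rewrite /= E.
Qed.

Definition machine_of (m : frag) : machine I := {|
  work := W;
  state := (pts m + bool)%type;
  ntapes := nt;
  start := inl (entry m);
  answer := fun s => if s is inr b then Some b else None;
  delta := fun s r =>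
    match s with
    | inl s => next s r
    | inr b => (inr b, [ffun i => (r i, Stay)])
    end
|}.

Lemma iter_machine_of m s ts k b ts' : runs s ts k b ts' ->
  iter k (@step I (machine_of m)) (inl s, ts) = (inr b, ts').
Proof.
have stepE (s1 : pts m) ts1 o a : next s1 (rd ts1) = (o, a) ->
    @step I (machine_of m) (inl s1, ts1) = (o, act a ts1).
  by move=> E; rewrite /step /= -/(rd ts1) E.
elim=> {s ts k b ts'} [s ts b a /stepE //|s s' ts ts' k b a /stepE E _ IH].
by rewrite iterSr E.
Qed.

Lemma answer_machine_of m w n k b ts' :
  k <= n -> runs (entry m) (@initial I (machine_of m) w).2 k b ts' ->
  @answer_within I (machine_of m) n w = Some b.
Proof.
move=> /subnK <- /iter_machine_of H; rewrite /answer_within iterD.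
have -> : initial (machine_of m) w =
  (inl (entry m), (@initial I (machine_of m) w).2) by [].
by rewrite H; elim: (n - k) => //= j; case: (iter _ _ _) => [[s|b'] ts].
Qed.

(** Head positions and contents as functions: unlike pairs of lists, they do not depend on the
    number of trailing blanks and can be compared pointwise. *)
Definition conf : Type := (tp -> nat) * (tp -> nat -> cell I W).

(* Only the cells to the right of the initial head position are used, so the
   left list has exactly as many cells as the head position. *)
Definition tape_at (t : tape I W) (p : nat) (A : nat -> cell I W) : Prop :=
  size t.1 = p /\ forall k, nth None (catrev t.1 t.2) k = A k.

Definition rep (s : conf) (ts : tapes) : Prop :=
  forall i, tape_at (ts i) (s.1 i) (s.2 i).

Definition move_pos (p : nat) (mv : move) : nat :=
  match mv with MoveLeft => p.-1 | Stay => p | MoveRight => p.+1 end.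

(** At position 0 the left list is empty; a left move there would insert a blank and shift all
    addresses by one. *)
Definition left_ok (p : nat) (mv : move) : bool :=
  if mv is MoveLeft then 0 < p else true.

Lemma tape_at_read t p A : tape_at t p A -> read t = A p.
Proof.
case: t => l r [/= <- <-]; rewrite catrevE nth_cat size_rev ltnn subnn.
by rewrite nth0.
Qed.

Lemma tape_at_write t p A c mv : tape_at t p A -> left_ok p mv ->
  tape_at (write_move t (c, mv)) (move_pos p mv)
    (fun k => if k == p then c else A k).
Proof.
have aux (l r : seq (cell I W)) k :
    nth None (rev l ++ c :: behead r) k =
    if k == size l then c else nth None (rev l ++ r) k.
  rewrite !nth_cat size_rev; case: ltngtP => // [lk|->]; last by rewrite subnn.
  by rewrite -(subnSK lk) /= nth_behead.
case: t => l r [/= <- H] ok; split.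
  by case: mv ok => //=; case: l {H}.
move=> k /=; rewrite -H [catrev l r]catrevE -aux; case: mv ok => //=; rewrite catrevE //.
by case: l {H} => //= x l _; rewrite rev_cons -cats1 -catA.
Qed.


(** A total-correctness triple: from every list representation of [s] the fragment leaves through
    exit [b] within [t] steps, in some representation of [s']. *)
Variant does (m : frag) (s : conf) (t : nat) (b : bool) (s' : conf) : Prop :=
  Does of forall ts, rep s ts ->
    exists k ts', [/\ k <= t, runs (entry m) ts k b ts' & rep s' ts'].

Lemma does_weaken m s t t' b s' : t <= t' -> does m s t b s' -> does m s t' b s'.
Proof.
move=> le [H]; split=> ts /H [k [ts' [lek r R]]]; exists k, ts'; split=> //.
exact: leq_trans le.
Qed.

Definition conf_read (s : conf) : reads := [ffun i => s.2 i (s.1 i)].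

Definition conf_act (a : acts) (s : conf) : conf :=
  (fun i => move_pos (s.1 i) (a i).2,
   fun i k => if k == s.1 i then (a i).1 else s.2 i k).

Lemma rep_act (a : acts) s ts : (forall i, left_ok (s.1 i) (a i).2) ->
  rep s ts -> rep (conf_act a s) (act a ts).
Proof.
move=> ok H i; rewrite ffunE /=.
by move: (ok i); case: (a i) => c mv /=; apply: tape_at_write.
Qed.

Lemma rep_read s ts : rep s ts -> rd ts = conf_read s.
Proof. by move=> H; apply/ffunP=> i; rewrite !ffunE; apply: tape_at_read. Qed.

Lemma does_prim (g : reads -> bool * acts) s :
  let ba := g (conf_read s) in
  (forall i, left_ok (s.1 i) (ba.2 i).2) ->
  does (prim g) s 1 ba.1 (conf_act ba.2 s).
Proof.
move=> ba ok; split=> ts H; exists 1, (act ba.2 ts); split=> //; last exact: rep_act.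
by have := runs_prim g ts; rewrite (rep_read H).
Qed.

Lemma does_ite m p q s t b s' t' b' s'' :
  does m s t b s' -> does (if b then p else q) s' t' b' s'' ->
  does (ite m p q) s (t + t') b' s''.
Proof.
move=> [H] H'; split=> ts /H [k [ts' [lek r R]]].
case: H' => /(_ _ R) [k' [ts'' [lek' r' R']]].
exists (k + k'), ts''; split=> //; first exact: leq_add.
by apply: runs_ite r _; case: b {H} r'.
Qed.

Lemma does_loop_exit m s t s' : does m s t false s' -> does (loop m) s t true s'.
Proof.
case=> H; split=> ts /H [k [ts' [lek r R]]]; exists k, ts'; split=> //.
exact: runs_loop_exit.
Qed.

Lemma does_loop_again m s t s' t' s'' :
  does m s t true s' -> does (loop m) s' t' true s'' ->
  does (loop m) s (t + t') true s''.
Proof.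
move=> [H] [H']; split=> ts /H [k [ts' [lek r /H' [k' [ts'' [lek' r' R]]]]]].
exists (k + k'), ts''; split=> //; first exact: leq_add.
exact: runs_loop_again r'.
Qed.

(** [sg k] is the configuration after [k] rounds; the extra summand in [N.+1] pays for the round
    that leaves the loop. *)
Lemma does_loop m t (sg : nat -> conf) N s' :
  (forall k, k < N -> does m (sg k) t true (sg k.+1)) ->
  does m (sg N) t false s' ->
  does (loop m) (sg 0) (N.+1 * t) true s'.
Proof.
elim: N sg => [|N IH] sg H H'; first by rewrite mul1n; apply: does_loop_exit.
rewrite mulSn; apply: does_loop_again (H 0 isT) _.
by apply: (IH (sg \o S)) => // k lek; apply: H.
Qed.

Definition moves (L R : seq tp) (i : tp) : move :=
  if i \in L then MoveLeft else if i \in R then MoveRight else Stay.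

Definition shift (h : tp -> nat) (L R : seq tp) (k : nat) (i : tp) : nat :=
  if i \in L then h i - k else if i \in R then h i + k else h i.

Definition move_if (c : reads -> bool) (L R : seq tp) : frag :=
  prim (fun r => (c r, [ffun i => (r i, if c r then moves L R i else Stay)])).

Definition ret (b : bool) : frag :=
  prim (fun r => (b, [ffun i => (r i, Stay)])).

Definition while (c : reads -> bool) (L R : seq tp) : frag := loop (move_if c L R).

Lemma conf_act_keep (h : tp -> nat) C (mv : tp -> move) :
  conf_act [ffun i => (conf_read (h, C) i, mv i)] (h, C) =
  (fun i => move_pos (h i) (mv i), C).
Proof.
congr pair; apply: funext => i; rewrite /= ?ffunE //=; apply: funext => k.
by case: eqP => // ->.
Qed.

Lemma does_mover (c : reads -> bool) (mv : reads -> tp -> move) h C :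
  let r := conf_read (h, C) in
  (forall i, left_ok (h i) (mv r i)) ->
  does (prim (fun r => (c r, [ffun i => (r i, mv r i)]))) (h, C) 1 (c r)
    (fun i => move_pos (h i) (mv r i), C).
Proof.
move=> r ok; rewrite -(conf_act_keep h C (mv r)).
apply: (@does_prim (fun r => (c r, [ffun i => (r i, mv r i)])) (h, C)) => i.
by rewrite ffunE.
Qed.

Lemma does_ret b s : does (ret b) s 1 b s.
Proof. by case: s => h C; apply: (@does_mover (fun=> b) (fun _ _ => Stay)). Qed.

Lemma does_move_if (c : reads -> bool) L R h C :
  let b := c (conf_read (h, C)) in
  (b -> forall i, i \in L -> 0 < h i) ->
  does (move_if c L R) (h, C) 1 b (if b then shift h L R 1 else h, C).
Proof.
move=> b ok.
have -> : (if b then shift h L R 1 else h) =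
    (fun i => move_pos (h i) (if b then moves L R i else Stay)).
  apply: funext => i; rewrite /moves /shift; case: (b) => //.
  by case: ifP; [rewrite subn1|case: ifP; rewrite // addn1].
apply: (@does_mover c (fun r i => if c r then moves L R i else Stay)) => i.
rewrite -/b; case: (b) ok => //= ok.
by rewrite /moves; case: ifP => [/(ok isT) //|]; case: ifP.
Qed.

Lemma does_while (c : reads -> bool) L R h C N :
  (forall k, k < N -> c (conf_read (shift h L R k, C))) ->
  c (conf_read (shift h L R N, C)) = false ->
  (forall i, i \in L -> N <= h i) ->
  does (while c L R) (h, C) N.+1 true (shift h L R N, C).
Proof.
move=> H H' ok; rewrite -[N.+1]muln1.
have {1}-> : h = shift h L R 0.
  by apply: funext => i; rewrite /shift subn0 addn0; case: ifP => //; case: ifP.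
apply: (@does_loop _ 1 (fun k => (shift h L R k, C))) => [k lek|].
  have := @does_move_if c L R (shift h L R k) C; rewrite H //=.
  rewrite (_ : shift (shift _ _ _ _) _ _ _ = shift h L R k.+1); last first.
    apply: funext => i; rewrite /shift; case: (i \in L); first by rewrite subn1 -subnS.
    by case: (i \in R); rewrite // addn1 addnS.
  by apply=> _ i iL; rewrite /shift iL subn_gt0 (leq_trans lek) ?ok.
by have := @does_move_if c L R (shift h L R N) C; rewrite H' /=; apply.
Qed.

End Fragments.

(** * Programs over word pointers and a table of facts *)

Section Pointers.
Variables (I Q : finType) (nt : nat).
Notation tp := 'I_nt.+1.
(** [None] is the mark at position 0 of a tape; [Some s] is a table cell holding the set [s] of
    relations true at its address. *)
Definition work_alphabet : finType := option {ffun Q -> bool}.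
Notation W := work_alphabet.
Notation cell := (cell I W).
Notation conf := (conf I W nt).
Notation frag := (frag I W nt).
Notation reads := {ffun tp -> cell}.

(** [tb] carries the table, the head of [u] serves as a unary counter, and [z] runs over the word to
    measure its length. *)
Variables tb u z : tp.
Hypothesis aux_uniq : uniq [:: tb; u; z].
Definition aux : seq tp := [:: tb; u; z].

Definition mark : cell := Some (inr None).

Definition upd (h : tp -> nat) (i : tp) (k : nat) (j : tp) : nat :=
  if j == i then k else h j.
Definition adv (h : tp -> nat) (d : nat) : tp -> nat := upd h tb (h tb + d).

Definition seqf (m p : frag) : frag := ite m p p.
Definition home (i : tp) : frag := while (fun r : reads => r i != mark) [:: i] [::].
Definition step_table : frag := move_if (fun _ : reads => true) [::] [:: tb].
(** Advances the table by one row: cells 0 to [n] of the padded word are not blank, which gives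
    [n + 1] moves, and one further step makes [n + 2]. *)
Definition sweep : frag :=
  seqf (while (fun r : reads => r z != None) [::] [:: z; tb])
    (seqf step_table (home z)).
Definition restore (i : tp) : frag := while (fun r : reads => r u != mark) [:: u] [:: i].
Definition goto_row (i : tp) : frag :=
  seqf (loop (ite (move_if (fun r : reads => r i != mark) [:: i] [:: u]) sweep
                (ret _ _ _ false)))
    (restore i).
Definition goto_col (j : tp) : frag :=
  seqf (while (fun r : reads => r j != mark) [:: j] [:: u; tb]) (restore j).
(* The table is stored row by row with rows of length n + 2.  The pointer i is
   unwound to its mark while u records the moves, each step of i advancing the
   table head by one row (a sweep of z over the word); u then restores i. *)
Definition goto (i : tp) (a : bool) (j : tp) (b : bool) : frag :=
  seqf (goto_row i)
    (seqf (if a then sweep else ret _ _ _ true)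
       (seqf (goto_col j) (if b then step_table else ret _ _ _ true))).

Section Word.
Variable w : seq I.
Notation n := (size w).

(** Letters occupy the positions from 1 on; position 0 holds the mark and serves as the home of a
    pointer not in use. *)
Definition padded (k : nat) : cell :=
  if k is k'.+1 then nth None [seq Some (inl a) | a <- w] k' else mark.

Definition pconf (h : tp -> nat) (B : nat -> cell) : conf :=
  (h, fun i => if i == tb then B else padded).

Lemma padded_mark k : (padded k != mark) = (0 < k).
Proof.
case: k => [|k] //=; case: (ltnP k n) => lek.
  by elim: w k lek => //= a s IH [|k] //= /IH.
by rewrite nth_default // size_map.
Qed.

Lemma padded_blank k : (padded k != None) = (k <= n).
Proof.
case: k => [|k] //=; case: (ltnP k n) => lek.
  by elim: w k lek => //= a s IH [|k] //= /IH.
by rewrite nth_default // size_map.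
Qed.

Lemma read_pointer h B i : i != tb -> conf_read (pconf h B) i = padded (h i).
Proof. by rewrite ffunE /= => /negPf ->. Qed.

Lemma read_table h B : conf_read (pconf h B) tb = B (h tb).
Proof. by rewrite ffunE /= eqxx. Qed.

Lemma does_seqf (m p : frag) s t b s' t' b' s'' :
  does m s t b s' -> does p s' t' b' s'' -> does (seqf m p) s (t + t') b' s''.
Proof. by move=> H H'; apply: does_ite H _; case: (b). Qed.

Lemma does_home h B i : i != tb ->
  does (home i) (pconf h B) (h i).+1 true (pconf (upd h i 0) B).
Proof.
move=> itb.
have -> : upd h i 0 = shift h [:: i] [::] (h i).
  by apply: funext => j; rewrite /upd /shift !inE; case: eqP => // ->; rewrite subnn.
have E k : shift h [:: i] [::] k i = h i - k by rewrite /shift !inE eqxx.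
apply: does_while => [k lek||j].
- by rewrite read_pointer // E padded_mark subn_gt0.
- by rewrite read_pointer // E padded_mark subnn.
- by rewrite inE => /eqP ->.
Qed.

Lemma does_home_table h B : (forall k, (B k != mark) = (0 < k)) ->
  does (home tb) (pconf h B) (h tb).+1 true (pconf (upd h tb 0) B).
Proof.
move=> HB.
have -> : upd h tb 0 = shift h [:: tb] [::] (h tb).
  by apply: funext => j; rewrite /upd /shift !inE; case: eqP => // ->; rewrite subnn.
have E k : shift h [:: tb] [::] k tb = h tb - k by rewrite /shift !inE eqxx.
apply: does_while => [k lek||j].
- by rewrite read_table E HB subn_gt0.
- by rewrite read_table E HB subnn.
- by rewrite inE => /eqP ->.
Qed.

Lemma does_step_table h B : does step_table (pconf h B) 1 true (pconf (adv h 1) B).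
Proof.
have -> : adv h 1 = shift h [::] [:: tb] 1.
  by apply: funext => j; rewrite /adv /upd /shift !inE; case: eqP => // ->.
by apply: (@does_move_if I W nt (fun=> true)).
Qed.

Lemma aux_neq : [/\ u != tb, z != tb, z != u & u != z].
Proof.
move: aux_uniq; rewrite /= !inE !negb_or !andbT => /andP[/andP[tu tz] uz].
by rewrite !(eq_sym z) eq_sym tu tz uz.
Qed.

Definition sweep_time := n.+2 + (1 + n.+2).

Lemma does_sweep h B : h z = 0 ->
  does sweep (pconf h B) sweep_time true (pconf (adv h n.+2) B).
Proof.
have [utb ztb _ _] := aux_neq.
move=> hz; set h1 := shift h [::] [:: z; tb] n.+1.
have h1z : h1 z = n.+1 by rewrite /h1 /shift !inE eqxx hz.
have h1tb : h1 tb = h tb + n.+1 by rewrite /h1 /shift !inE eqxx orbT.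
have -> : adv h n.+2 = upd (adv h1 1) z 0.
  apply: funext => j; rewrite /adv /upd h1tb.
  case: eqP => [->|jtb]; first by rewrite eq_sym (negPf ztb) -addnA addn1.
  case: eqP => [-> //|jz]; rewrite /h1 /shift !inE.
  by rewrite (negPf (introN eqP jz)) (negPf (introN eqP jtb)).
have E : (adv h1 1) z = n.+1 by rewrite /adv /upd (negPf ztb).
apply: (@does_seqf _ _ _ _ true (pconf h1 B)); last first.
  apply: (does_seqf (does_step_table h1 B)).
  by rewrite -{1}E; apply: does_home.
apply: does_while => //= [k lek|].
- by rewrite read_pointer // /shift !inE eqxx hz padded_blank -ltnS.
- by rewrite read_pointer // -/h1 h1z padded_blank ltnn.
Qed.

Lemma does_restore h B i : i \notin aux ->
  does (restore i) (pconf h B) (h u).+1 true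
    (pconf (upd (upd h u 0) i (h i + h u)) B).
Proof.
rewrite !inE !negb_or => /and3P[itb iu iz]; have [utb _ _ _] := aux_neq.
have -> : upd (upd h u 0) i (h i + h u) = shift h [:: u] [:: i] (h u).
  apply: funext => j; rewrite /upd /shift !inE; case: (eqVneq j i) => [->|ji].
    by rewrite (negPf iu).
  by case: eqP => // ->; rewrite subnn.
have E k : shift h [:: u] [:: i] k u = h u - k by rewrite /shift !inE eqxx.
apply: does_while => [k lek||j].
- by rewrite read_pointer // E padded_mark subn_gt0.
- by rewrite read_pointer // E padded_mark subnn.
- by rewrite inE => /eqP ->.
Qed.

Lemma does_goto_row h B i : i \notin aux -> h u = 0 -> h z = 0 ->
  does (goto_row i) (pconf h B) ((h i).+1 * (1 + sweep_time) + (h i).+1) true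
    (pconf (adv h (h i * n.+2)) B).
Proof.
move=> iaux; move: (iaux); rewrite !inE !negb_or => /and3P[itb iu iz] hu hz.
have [utb ztb zu uz] := aux_neq.
(* The configuration after [k] rounds. The positions of [i] and [u] keep the sum [h i], so [restore]
   can put [i] back. *)
pose g k j := if j == i then h i - k else if j == u then k
              else if j == tb then h tb + k * n.+2 else h j.
have g0 : h = g 0.
  apply: funext => j; rewrite /g subn0 mul0n addn0.
  by do 3!(case: eqP => [->|_] //).
have gu : g (h i) u = h i by rewrite /g eqxx eq_sym (negPf iu).
apply: (@does_seqf _ _ _ _ true (pconf (g (h i)) B)); last first.
  have -> : adv h (h i * n.+2) = upd (upd (g (h i)) u 0) i (g (h i) i + g (h i) u).
    apply: funext => j; rewrite gu /adv /upd /g eqxx subnn add0n.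
    case: (eqVneq j tb) => [->|jtb]; first by rewrite eq_sym (negPf itb) eq_sym (negPf utb).
    case: eqP => [-> //|_]; by case: eqP => [->|_].
  by rewrite -{2}gu; apply: does_restore.
rewrite {1}g0; apply: (@does_loop _ _ _ _ _ (fun k => pconf (g k) B)) => [k lek|].
- have gi : conf_read (pconf (g k) B) i != mark.
    by rewrite read_pointer // padded_mark /g eqxx subn_gt0.
  pose g' := shift (g k) [:: i] [:: u] 1.
  have -> : g k.+1 = adv g' n.+2.
    apply: funext => j; rewrite /adv /upd /g' /shift /g !inE.
    case: (eqVneq j i) => [->|ji]; first by rewrite (negPf itb) subnS subn1.
    case: (eqVneq j u) => [->|ju]; first by rewrite (negPf utb) addn1.
    case: (eqVneq j tb) => [_|] //.
    rewrite [tb == i]eq_sym (negPf itb) [tb == u]eq_sym (negPf utb) eqxx.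
    by rewrite mulSn -addnA [n.+2 + _]addnC.
  apply: (@does_ite _ _ _ _ _ _ _ 1 true (pconf g' B)).
    have := @does_move_if I W nt (fun r => r i != mark) [:: i] [:: u] (g k)
      (pconf (g k) B).2.
    rewrite gi; apply=> _ j; rewrite inE => /eqP ->.
    by rewrite /g eqxx subn_gt0.
  apply: does_sweep.
  by rewrite /g' /shift /g !inE [z == i]eq_sym (negPf iz) (negPf zu) (negPf ztb).
- have gi : (conf_read (pconf (g (h i)) B) i != mark) = false.
    by rewrite read_pointer // padded_mark /g eqxx subnn.
  apply: (@does_ite _ _ _ _ _ _ _ 1 false (pconf (g (h i)) B)).
    have := @does_move_if I W nt (fun r => r i != mark) [:: i] [:: u] (g (h i))
      (pconf (g (h i)) B).2.
    by rewrite gi; apply.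
  by apply: (@does_weaken _ _ _ _ _ 1) => //; apply: does_ret.
Qed.

Lemma does_goto_col h B j : j \notin aux -> h u = 0 ->
  does (goto_col j) (pconf h B) ((h j).+1 + (h j).+1) true (pconf (adv h (h j)) B).
Proof.
move=> jaux; move: (jaux); rewrite !inE !negb_or => /and3P[jtb ju jz] hu.
have [utb ztb zu uz] := aux_neq.
set g := shift h [:: j] [:: u; tb] (h j).
have gu : g u = h j by rewrite /g /shift !inE eqxx [u == j]eq_sym (negPf ju) hu.
have gj : g j = 0 by rewrite /g /shift !inE eqxx subnn.
apply: (@does_seqf _ _ _ _ true (pconf g B)); last first.
  have -> : adv h (h j) = upd (upd g u 0) j (g j + g u).
    apply: funext => i; rewrite gu gj /adv /upd.
    case: (eqVneq i tb) => [->|itb].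
      rewrite eq_sym (negPf jtb) eq_sym (negPf utb).
      by rewrite /g /shift !inE eqxx orbT eq_sym (negPf jtb).
    case: eqP => [-> //|/eqP ij]; case: eqP => [-> //|/eqP iu].
    by rewrite /g /shift !inE (negPf ij) (negPf iu) (negPf itb).
  by rewrite -{1}gu; apply: does_restore.
have E k : shift h [:: j] [:: u; tb] k j = h j - k by rewrite /shift !inE eqxx.
apply: does_while => [k lek||i].
- by rewrite read_pointer // E padded_mark subn_gt0.
- by rewrite read_pointer // E padded_mark subnn.
- by rewrite inE => /eqP ->.
Qed.

Definition goto_time :=
  n.+1 * (1 + sweep_time) + n.+1 + (sweep_time + (n.+1 + n.+1 + 1)).

Lemma does_goto h B i a j b : i \notin aux -> j \notin aux ->
  h u = 0 -> h z = 0 -> h i <= n -> h j <= n ->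
  does (goto i a j b) (pconf h B) goto_time true
    (pconf (adv h ((h i + a) * n.+2 + (h j + b))) B).
Proof.
move=> iaux jaux hu hz hi hj.
have [utb ztb zu uz] := aux_neq.
have advE g d j' : j' != tb -> adv g d j' = g j' by rewrite /adv /upd => /negPf ->.
have advD g d d' : adv (adv g d) d' = adv g (d + d').
  by apply: funext => k; rewrite /adv /upd eqxx addnA; case: eqP.
have adv0 g : adv g 0 = g.
  by apply: funext => k; rewrite /adv /upd addn0; case: eqP => // ->.
have jtb : j != tb by move: jaux; rewrite !inE !negb_or => /and3P[].
have -> : adv h ((h i + a) * n.+2 + (h j + b)) =
    adv (adv (adv (adv h (h i * n.+2)) (a * n.+2)) (h j)) b.
  by rewrite !advD mulnDl !addnA.
apply: does_seqf.
  apply: does_weaken (does_goto_row B iaux hu hz).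
  by rewrite leq_add // leq_mul.
apply: (@does_seqf _ _ _ _ true (pconf (adv (adv h (h i * n.+2)) (a * n.+2)) B)).
  case: (a) => /=; first by rewrite mul1n; apply: does_sweep; rewrite advE.
  by rewrite mul0n adv0; apply: does_weaken (does_ret _ _).
apply: (@does_seqf _ _ _ _ true (pconf (adv (adv (adv h (h i * n.+2)) (a * n.+2)) (h j)) B)).
  have := @does_goto_col (adv (adv h (h i * n.+2)) (a * n.+2)) B j jaux.
  rewrite !advE // => /(_ hu); apply: does_weaken; first by rewrite leq_add.
case: (b) => /=; first exact: does_step_table.
by rewrite adv0; apply: does_ret.
Qed.

End Word.

Definition store : Type := Q -> nat -> nat -> bool.

Definition put (X : store) q x y : store :=
  fun q' x' y' => [&& q' == q, x' == x & y' == y] || X q' x' y'.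

(** [All] is the only iteration and visits each position at most once, so the running time is
    polynomial by the mere shape of a program. The boolean offsets of [Look] and [Put] address the
    position after a pointer. *)
Inductive prog :=
| Skip
| Test of cell -> bool & tp
| TestLeft of cell -> bool & tp
| Look of Q & tp & bool & tp & bool
| Put of Q & tp & bool & tp & bool
| Neg of prog
| And of prog & prog
| All of tp & prog.

Fixpoint eval (w : seq I) (p : prog) (h : tp -> nat) (X : store) : bool * store :=
  match p with
  | Skip => (true, X)
  | Test P i => (P (padded w (h i)), X)
  | TestLeft P i => (P (padded w (h i).-1), X)
  | Look q i a j b => (X q (h i + a) (h j + b), X)
  | Put q i a j b => (true, put X q (h i + a) (h j + b))
  | Neg p => (~~ (eval w p h X).1, (eval w p h X).2)
  | And p p' => if (eval w p h X).1 then eval w p' h (eval w p h X).2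
                else (false, (eval w p h X).2)
  | All i p =>
      foldl (fun s k => if s.1 then eval w p (upd h i k) s.2 else s) (true, X)
        (iota 1 (size w))
  end.

Definition decode (c : cell) (q : Q) : bool :=
  if c is Some (inr (Some s)) then s q else false.

Definition write_fact (q : Q) : frag :=
  prim (fun r : reads => (true, [ffun i =>
    (if i == tb then Some (inr (Some [ffun q' => (q' == q) || decode (r tb) q']))
     else r i, Stay)])).

Definition stay_if (c : reads -> bool) : frag := move_if c [::] [::].
Definition go_left (i : tp) : frag := move_if (fun _ : reads => true) [:: i] [::].
Definition go_right (i : tp) : frag := move_if (fun _ : reads => true) [::] [:: i].
(** [p] cleans up after [m]. The answer of [m] survives in the control state, one copy of [p] being
    used for each answer; [p] itself is expected to leave through [true]. *)
Definition finally (m p : frag) : frag := ite m p (seqf p (ret _ _ _ false)).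

(** A loop forgets why it ended, so [All] recovers its answer from the place where the pointer
    stopped: on a blank if every position passed, on a letter if the body failed there. *)
Fixpoint compile (p : prog) : frag :=
  match p with
  | Skip => ret _ _ _ true
  | Test P i => stay_if (fun r => P (r i))
  | TestLeft P i => seqf (go_left i) (finally (stay_if (fun r => P (r i))) (go_right i))
  | Look q i a j b =>
      seqf (goto i a j b) (finally (stay_if (fun r => decode (r tb) q)) (home tb))
  | Put q i a j b => seqf (goto i a j b) (seqf (write_fact q) (home tb))
  | Neg p => ite (compile p) (ret _ _ _ false) (ret _ _ _ true)
  | And p p' => ite (compile p) (compile p') (ret _ _ _ false)
  | All i p =>
      seqf (loop (seqf (go_right i)
              (ite (stay_if (fun r => r i != None)) (compile p) (ret _ _ _ false))))
        (finally (stay_if (fun r => r i == None)) (home i))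
  end.

Definition busy (D : tp -> bool) (i : tp) (j : tp) : bool := (j == i) || D j.

(** [D] collects the pointers bound by the enclosing quantifiers. No pointer is rebound inside its
    own scope and none is auxiliary, so each quantifier finds its pointer at home. *)
Fixpoint well_scoped (D : tp -> bool) (p : prog) : bool :=
  match p with
  | Skip => true
  | Test _ i | TestLeft _ i => D i
  | Look _ i _ j _ | Put _ i _ j _ => D i && D j
  | Neg p => well_scoped D p
  | And p p' => well_scoped D p && well_scoped D p'
  | All i p => [&& ~~ D i, i \notin aux & well_scoped (busy D i) p]
  end.

Fixpoint time (w : seq I) (p : prog) : nat :=
  match p with
  | Skip | Test _ _ => 1
  | TestLeft _ _ => 1 + (1 + (1 + 1))
  | Look _ _ _ _ _ | Put _ _ _ _ _ =>
      goto_time w + (1 + (((size w).+1 * (size w).+2 + (size w).+1).+1 + 1))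
  | Neg p => time w p + 1
  | And p p' => time w p + (time w p' + 1)
  | All i p => (size w).+1 * (1 + (1 + (time w p + 1))) + (1 + ((size w).+2 + 1))
  end.

(** * Correctness of the compiled programs *)

Section Correctness.
Variable w : seq I.
Notation n := (size w).

(** Row 0 is left out: it contains cell 0, whose mark, the only one on the tape, brings the table
    head home. Bound pointers are positive and never address that row. *)
Definition tabulates (X : store) (B : nat -> cell) : Prop :=
  (forall k, (B k != mark) = (0 < k)) /\
  forall q x y, 0 < x <= n.+1 -> y <= n.+1 -> decode (B (x * n.+2 + y)) q = X q x y.

Definition ready (D : tp -> bool) (h : tp -> nat) : Prop :=
  forall i, h i <= n /\ (0 < h i) = D i.

Lemma does_finally m p s t b s' t' s'' :
  does m s t b s' -> does p s' t' true s'' -> does (finally m p) s (t + (t' + 1)) b s''.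
Proof.
move=> H H'; apply: does_ite H _; case: b; first by apply: does_weaken H'; rewrite leq_addr.
exact: does_seqf H' (does_ret _ _).
Qed.

Lemma does_stay_if (c : reads -> bool) s : does (stay_if c) s 1 (c (conf_read s)) s.
Proof.
case: s => h C; have /= := @does_move_if I W nt c [::] [::] h C.
have -> : (if c (conf_read (h, C)) then shift h [::] [::] 1 else h) = h.
  by case: (c _) => //; apply: funext.
exact.
Qed.

Lemma does_go_left h C i : 0 < h i -> does (go_left i) (h, C) 1 true (upd h i (h i).-1, C).
Proof.
move=> hi; have -> : upd h i (h i).-1 = shift h [:: i] [::] 1.
  by apply: funext => j; rewrite /upd /shift inE; case: eqP => // ->; rewrite subn1.
by apply: (@does_move_if I W nt (fun=> true)) => _ j; rewrite inE => /eqP ->.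
Qed.

Lemma does_go_right h C i : does (go_right i) (h, C) 1 true (upd h i (h i).+1, C).
Proof.
have -> : upd h i (h i).+1 = shift h [::] [:: i] 1.
  by apply: funext => j; rewrite /upd /shift !inE; case: eqP => // ->; rewrite addn1.
by apply: (@does_move_if I W nt (fun=> true)).
Qed.

Lemma upd_id h i : upd h i (h i) = h.
Proof. by apply: funext => j; rewrite /upd; case: eqP => // ->. Qed.

Lemma upd_upd h i k k' : upd (upd h i k) i k' = upd h i k'.
Proof. by apply: funext => j; rewrite /upd; case: eqP. Qed.

Lemma upd_same h i k : upd h i k i = k.
Proof. by rewrite /upd eqxx. Qed.

Lemma does_write_fact q h B :
  does (write_fact q) (pconf w h B) 1 true
    (pconf w h (fun k => if k == h tb
      then Some (inr (Some [ffun q' => (q' == q) || decode (B (h tb)) q']))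
      else B k)).
Proof.
have := @does_prim I W nt (fun r : reads => (true, [ffun i =>
    (if i == tb then Some (inr (Some [ffun q' => (q' == q) || decode (r tb) q']))
     else r i, Stay)])) (pconf w h B).
move=> /=; rewrite (_ : conf_act _ _ = pconf w h (fun k => if k == h tb
      then Some (inr (Some [ffun q' => (q' == q) || decode (B (h tb)) q']))
      else B k)); first by apply=> i; rewrite ffunE.
congr pair; apply: funext => i; first by rewrite ffunE.
apply: funext => k; rewrite !ffunE /=; case: eqP => [->|kh]; first by case: (eqVneq i tb) => [->|//]; rewrite !eqxx.
by case: (eqVneq i tb) => [ei|//]; rewrite -ei; case: eqP kh.
Qed.

(** Division with remainder by the row length [n + 2]. *)
Lemma address_inj x y x' y' : y <= n.+1 -> y' <= n.+1 ->
  (x * n.+2 + y == x' * n.+2 + y') = (x == x') && (y == y').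
Proof.
move=> hy hy'; apply/eqP/andP => [E|[/eqP-> /eqP->] //].
have Ex : x = x'.
  by have := congr1 (divn^~ n.+2) E; rewrite !divnMDl // !divn_small // !addn0.
by move/eqP: E; rewrite Ex eqn_add2l.
Qed.

Lemma tabulates_put X B q x y : tabulates X B -> 0 < x <= n.+1 -> y <= n.+1 ->
  tabulates (put X q x y) (fun k => if k == x * n.+2 + y
    then Some (inr (Some [ffun q' => (q' == q) || decode (B (x * n.+2 + y)) q']))
    else B k).
Proof.
move=> [HB HX] hx hy; split=> [k|q' x' y' hx' hy'].
  case: (eqVneq k (x * n.+2 + y)) => [->|//]; rewrite /=; apply/esym; rewrite addn_gt0 muln_gt0.
  by case/andP: hx => ->.
rewrite address_inj // /put; case: (eqVneq x' x) => [->|_] /=; last by rewrite andbF HX.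
case: (eqVneq y' y) => [->|_] /=; last by rewrite andbF HX.
by rewrite ffunE HX // andbT.
Qed.

Lemma offset_le k (a : bool) : k <= n -> k + a <= n.+1.
Proof. by case: a => hk; rewrite ?addn0 ?addn1 ?ltnS // leqW. Qed.

Lemma does_home_back h B d : h tb = 0 -> d <= n.+1 * n.+2 + n.+1 ->
  (forall k, (B k != mark) = (0 < k)) ->
  does (home tb) (pconf w (adv h d) B) (n.+1 * n.+2 + n.+1).+1 true (pconf w h B).
Proof.
move=> h0 hd HB.
have E : (adv h d) tb = d by rewrite /adv upd_same h0.
rewrite -[X in does _ _ _ _ (pconf w X _)](upd_id h tb) h0.
rewrite -(upd_upd h tb (h tb + d)) -/(adv h d).
by apply: does_weaken (does_home_table _ _ HB); rewrite E.
Qed.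

Arguments padded : simpl never.

Lemma does_compile_all p h i :
  i \notin aux -> h i = 0 ->
  (forall k X B, 0 < k <= n -> tabulates X B ->
     exists2 B', tabulates (eval w p (upd h i k) X).2 B' &
       does (compile p) (pconf w (upd h i k) B) (time w p)
         (eval w p (upd h i k) X).1 (pconf w (upd h i k) B')) ->
  forall X B, tabulates X B ->
  exists2 B', tabulates (eval w (All i p) h X).2 B' &
    does (compile (All i p)) (pconf w h B) (time w (All i p))
      (eval w (All i p) h X).1 (pconf w h B').
Proof.
move=> iaux hi H.
have itb : i != tb by apply: contraNneq iaux => ->; rewrite inE eqxx.
have h0 : upd h i 0 = h by rewrite -[RHS](upd_id h i) hi.
have blankE k : (padded w k == None) = (n < k) by rewrite ltnNge -padded_blank negbK.
pose f s k := if s.1 then eval w p (upd h i k) s.2 else s.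
have f_false X s : foldl f (false, X) s = (false, X) by elim: s.
set t := 1 + (1 + (time w p + 1)).
set body := seqf (go_right i) (ite (stay_if (fun r => r i != None)) (compile p) (ret I W nt false)).
have Hright k B : does (go_right i) (pconf w (upd h i k) B) 1 true (pconf w (upd h i k.+1) B).
  have := does_go_right (upd h i k) (pconf w h B).2 i.
  by rewrite upd_upd upd_same.
have Htest c k B : does (stay_if (fun r => c (r i))) (pconf w (upd h i k) B) 1
    (c (padded w k)) (pconf w (upd h i k) B).
  have := does_stay_if (fun r => c (r i)) (pconf w (upd h i k) B).
  by rewrite read_pointer // upd_same.
(* [d] positions remain. The final pointer position [k'] encodes the answer: [n + 1] when all
   positions passed, otherwise the first position that failed. *)
have loopP d k X B : d + k = n -> tabulates X B ->
    exists B' k', let s := foldl f (true, X) (iota k.+1 d) in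
    [/\ tabulates s.2 B', k' <= n.+1, (padded w k' == None) = s.1 &
       does (loop body) (pconf w (upd h i k) B) (d.+1 * t) true (pconf w (upd h i k') B')].
  elim: d k X B => [|d IH] k X B dk T.
    exists B, k.+1; rewrite -[k]add0n dk; split=> //=.
      by rewrite blankE ltnSn.
    rewrite mul1n; apply/does_loop_exit/(does_seqf (Hright _ _)).
    apply: (does_ite (Htest (fun c => c != None) n.+1 B)).
    rewrite padded_blank ltnn.
    by apply: does_weaken (does_ret _ _); rewrite leq_addl.
  have kn : k < n by rewrite -dk addSn ltnS leq_addl.
  have [|B1 T1 D1] := H k.+1 X B _ T; first by [].
  have Hbody : does body (pconf w (upd h i k) B) t (eval w p (upd h i k.+1) X).1
      (pconf w (upd h i k.+1) B1).
    apply/(does_seqf (Hright _ _)).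
    apply: (does_ite (Htest (fun c => c != None) k.+1 B)).
    by rewrite padded_blank kn; apply: does_weaken D1; rewrite leq_addr.
  rewrite /= -/f (_ : f (true, X) k.+1 = eval w p (upd h i k.+1) X) //.
  move: Hbody T1; case: (eval w p (upd h i k.+1) X) => [[] X1] /= Hbody T1.
    have [|B2 [k' [T2 lek' ek' D2]]] := IH k.+1 X1 B1 _ T1; first by rewrite addnS.
    by exists B2, k'; split=> //; rewrite mulSn; apply: does_loop_again Hbody D2.
  exists B1, k.+1; rewrite f_false; split=> //; first exact: ltnW.
    by rewrite blankE ltnNge kn.
  by apply: does_weaken (does_loop_exit Hbody); rewrite mulSn leq_addr.
move=> X B T; have [|B' [k' [T' lek' ek' D']]] := loopP n 0 X B _ T; first exact: addn0.
exists B' => //; rewrite /= -/f -ek'.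
apply: (@does_seqf _ _ _ _ true (pconf w (upd h i k') B')).
  by move: D'; rewrite h0.
apply: does_finally (Htest (fun c => c == None) k' B') _.
have := @does_home w (upd h i k') B' i itb.
by rewrite upd_upd h0 upd_same; apply: does_weaken.
Qed.

(** Every construct returns all heads to [h], so only the table content changes from one construct
    to the next and the induction hypotheses compose. *)
Theorem compile_correct p D h X B :
  well_scoped D p -> (forall i, i \in aux -> D i = false) -> ready D h ->
  tabulates X B ->
  exists2 B', tabulates (eval w p h X).2 B' &
    does (compile p) (pconf w h B) (time w p) (eval w p h X).1 (pconf w h B').
Proof.
have notaux D0 j : (forall i, i \in aux -> D0 i = false) -> D0 j -> j \notin aux.
  by move=> H Dj; apply/negP=> /H; rewrite Dj.
have h_aux D0 h0 j : (forall i, i \in aux -> D0 i = false) -> ready D0 h0 ->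
    j \in aux -> h0 j = 0.
  by move=> H R /H Dj; have [_] := R j; rewrite Dj; case: (h0 j).
elim: p D h X B => [|P i|P i|q i a j b|q i a j b|p IH|p IH p' IH'|i p IH] D h X B /= ws Daux hh T.
- by exists B => //; apply: does_ret.
- exists B => //; have := does_stay_if (fun r => P (r i)) (pconf w h B).
  by rewrite read_pointer //; apply: contraL ws => /eqP ->; rewrite Daux ?inE ?eqxx.
- have itb : i != tb by apply: contraL ws => /eqP ->; rewrite Daux ?inE ?eqxx.
  exists B => //; have [_ hi] := hh i; rewrite ws in hi.
  apply: (does_seqf (does_go_left _ hi)).
  apply: (@does_finally _ _ _ _ _ (pconf w (upd h i (h i).-1) B)).
    have := does_stay_if (fun r => P (r i)) (pconf w (upd h i (h i).-1) B).
    by rewrite read_pointer // upd_same.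
  have := does_go_right (upd h i (h i).-1) (pconf w h B).2 i.
  by rewrite upd_upd upd_same prednK // upd_id.
- have {}h_aux j' := h_aux D h j' Daux hh; have {}notaux j' := notaux D j' Daux.
  have [/andP[Di Dj] [hi Hi] [hj Hj]] := And3 ws (hh i) (hh j).
  rewrite Di in Hi; exists B => //.
  have uaux : u \in aux by rewrite !inE eqxx orbT.
  have zaux : z \in aux by rewrite !inE eqxx !orbT.
  have taux : tb \in aux by rewrite !inE eqxx.
  apply: (does_seqf (@does_goto w h B i a j b (notaux _ Di) (notaux _ Dj)
    (h_aux _ uaux) (h_aux _ zaux) hi hj)).
  set d := _ * _ + _.
  apply: (@does_finally _ _ _ _ _ (pconf w (adv h d) B)).
    have := does_stay_if (fun r => decode (r tb) q) (pconf w (adv h d) B).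
    rewrite read_table /adv upd_same (h_aux _ taux) -(proj2 T) //.
      by rewrite addn_gt0 Hi offset_le.
    exact: offset_le.
  apply: does_home_back (proj1 T); first exact: h_aux.
  by rewrite leq_add ?leq_mul ?offset_le.
- have {}h_aux j' := h_aux D h j' Daux hh; have {}notaux j' := notaux D j' Daux.
  have [/andP[Di Dj] [hi Hi] [hj Hj]] := And3 ws (hh i) (hh j).
  rewrite Di in Hi.
  have hx : 0 < h i + a <= n.+1 by rewrite addn_gt0 Hi offset_le.
  have hy : h j + b <= n.+1 by rewrite offset_le.
  have T' := tabulates_put q T hx hy; eexists; first exact: T'.
  have uaux : u \in aux by rewrite !inE eqxx orbT.
  have zaux : z \in aux by rewrite !inE eqxx !orbT.
  have taux : tb \in aux by rewrite !inE eqxx.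
  apply: (does_seqf (@does_goto w h B i a j b (notaux _ Di) (notaux _ Dj)
    (h_aux _ uaux) (h_aux _ zaux) hi hj)).
  apply: (does_seqf (does_write_fact _ _ _)).
  rewrite /adv upd_same (h_aux _ taux) add0n -[X in upd _ _ X]add0n.
  rewrite -{1}(h_aux _ taux) -/(adv h _).
  apply: does_weaken (does_home_back _ _ (proj1 T')); first by rewrite leq_addr.
    exact: h_aux.
  by rewrite leq_add ?leq_mul ?offset_le //; case/andP: hx.
- have [B' T' D'] := IH D h X B ws Daux hh T; exists B' => //.
  by apply: (does_ite D'); case: (_.1); apply: does_ret.
- case/andP: ws => ws ws'; have [B1 T1 D1] := IH D h X B ws Daux hh T.
  have [B2 T2 D2] := IH' D h _ B1 ws' Daux hh T1.
  move: D1 T2 D2 T1; case: (eval w p h X) => [[] X1] /= D1 T2 D2 T1.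
    by exists B2 => //; apply: (does_ite D1); apply: does_weaken D2; rewrite leq_addr.
  exists B1 => //; apply: (does_ite D1).
  by apply: does_weaken (does_ret _ _); rewrite leq_addl.
- case/and3P: ws => NDi iaux ws; apply: does_compile_all T => //.
    by have [_] := hh i; rewrite (negPf NDi); case: (h i).
  move=> k X1 B1 /andP[k0 kn]; apply: IH ws _ _ => [j jaux|j].
    by rewrite /busy Daux // orbF; apply: contraNF iaux => /eqP <-.
  by rewrite /upd /busy; case: eqP => // _; apply: hh.
Qed.

End Correctness.
End Pointers.

(** * From the initial tapes to marked copies of the word *)

Section Initialization.
Variables (I Q : finType) (nt : nat).
Notation tp := 'I_nt.+1.
Notation W := (work_alphabet Q).
Notation cell := (cell I W).
Notation conf := (conf I W nt).
Notation frag := (frag I W nt).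
Notation reads := {ffun tp -> cell}.
Notation mark := (mark I Q).

(** The input starts right under its head and leaves no room for a mark. Its head therefore moves
    left, to a fresh cell that becomes position 0, while the other tapes are marked where they
    stand. *)
Definition mark_others : frag := prim (fun r : reads => (true,
  [ffun i => if i == ord0 then (r i, MoveLeft) else (mark, MoveRight)])).
Definition mark_input : frag := prim (fun r : reads => (true,
  [ffun i => if i == ord0 then (mark, MoveRight) else (r i, Stay)])).
Definition copy_cell : frag := prim (fun r : reads => (r ord0 != None,
  [ffun i => if r ord0 != None then (r ord0, MoveRight) else (r i, Stay)])).
(* The word is copied onto every tape, the table included: a letter of the word
   decodes to the empty set of facts. *)
Definition prepare : frag :=
  seqf mark_input (seqf (loop copy_cell)
    (while (fun r : reads => r ord0 != mark) (enum tp) [::])).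

Section Word.
Variable w : seq I.
Notation n := (size w).
Notation padded := (padded Q w).

(** Loop invariant of the copying: the first [k] letters are on every tape. *)
Definition copied (k : nat) : conf :=
  (fun=> k.+1,
   fun i j => if (i == ord0) || (j <= k) then padded j else None).

Definition marked : conf :=
  (fun i => nat_of_bool (i != ord0),
   fun i j => if i == ord0 then if j is j'.+1 then padded j else None
              else if j == 0 then mark else None).

Lemma does_copy_cell k : k < n -> does copy_cell (copied k) 1 true (copied k.+1).
Proof.
move=> lek; have := @does_prim I W nt (fun r : reads => (r ord0 != None,
  [ffun i => if r ord0 != None then (r ord0, MoveRight) else (r i, Stay)])) (copied k).
move=> /=; have -> : conf_read (copied k) ord0 = padded k.+1 by rewrite ffunE.
rewrite padded_blank lek.
rewrite (_ : conf_act _ _ = copied k.+1); first by apply=> i; rewrite ffunE.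
congr pair; apply: funext => i; first by rewrite ffunE.
apply: funext => j; rewrite ffunE /= [j <= k.+1]leq_eqVlt ltnS.
by case: eqP => [->|] //; rewrite orbT.
Qed.

Lemma does_copy : does (loop copy_cell) (copied 0) (n.+1 * 1) true (copied n).
Proof.
apply: does_loop => [k|]; first exact: does_copy_cell.
have := @does_prim I W nt (fun r : reads => (r ord0 != None,
  [ffun i => if r ord0 != None then (r ord0, MoveRight) else (r i, Stay)])) (copied n).
move=> /=; have -> : conf_read (copied n) ord0 = padded n.+1 by rewrite ffunE.
rewrite padded_blank ltnn.
rewrite (_ : conf_act _ _ = copied n); first by apply=> i; rewrite ffunE.
congr pair; apply: funext => i; first by rewrite ffunE.
apply: funext => j; rewrite !ffunE /=.
by case: eqP => // ->.
Qed.

Lemma does_prepare tb :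
  does prepare marked (1 + (n.+1 * 1 + n.+2)) true (pconf tb w (fun=> 0) padded).
Proof.
have padded0 : padded 0 = mark by [].
apply: (@does_seqf _ _ _ _ _ _ _ true (copied 0)).
  have := @does_prim I W nt (fun r : reads => (true,
    [ffun i => if i == ord0 then (mark, MoveRight) else (r i, Stay)])) marked.
  move=> /=; rewrite (_ : conf_act _ _ = copied 0).
    by apply=> i; rewrite ffunE; case: eqP.
  congr pair; apply: funext => i; first by rewrite ffunE /=; case: (i == ord0).
  by apply: funext => -[|[|j]]; rewrite !ffunE /=; case: (i == ord0).
apply: (does_seqf does_copy).
have E k : shift (copied n).1 (enum tp) [::] k = fun=> n.+1 - k.
  by apply: funext => i; rewrite /shift mem_enum.
have -> : pconf tb w (fun=> 0) padded = (shift (copied n).1 (enum tp) [::] n.+1, (copied n).2).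
  rewrite E subnn; congr pair; apply: funext => i /=.
  rewrite if_same; apply: funext => j; case: ifP => // /negbT.
  rewrite negb_or -ltnNge => /andP[_ lj]; apply/eqP.
  by rewrite -[_ == _]negbK padded_blank -ltnNge.
have F k : conf_read (shift (copied n).1 (enum tp) [::] k, (copied n).2) ord0 = padded (n.+1 - k).
  by rewrite ffunE E.
apply: does_while => [k lek||//]; rewrite F padded_mark.
  by rewrite subn_gt0.
by rewrite subnn.
Qed.

(** The first move takes the input head left of its initial cell, which [left_ok] forbids. It is
    carried out on the concrete tapes, and positions are counted from the new cell afterwards. *)
Theorem initialized_run tb p k b B' :
  does p (pconf tb w (fun=> 0) padded) k b (pconf tb w (fun=> 0) B') ->
  exists k' ts', k' <= n.+1 + n.+4 + k /\
    runs (entry (seqf mark_others (seqf prepare p)))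
      (@initial I (machine_of p) w).2 k' b ts'.
Proof.
move=> /(does_seqf (does_prepare tb)) [H].
pose ts : {ffun tp -> tape I W} := (@initial I (machine_of p) w).2.
pose a : {ffun tp -> cell * move} :=
  [ffun i => if i == ord0 then (rd ts i, MoveLeft) else (mark, MoveRight)].
have R : rep marked (act a ts).
  move=> i; rewrite /tape_at /marked !ffunE /=; case: (i == ord0) => /=.
    by split=> // -[|[|j]] //=; rewrite /padded; case: (w) => //=; rewrite nth_nil.
  by split=> // -[|[|j]].
have [k' [ts' [lek r _]]] := H _ R.
exists (1 + k'), ts'; split.
  apply: leq_trans (leq_add (leqnn 1) lek) _; lia.
have r1 : runs (entry mark_others) ts 1 true (act a ts).
  exact: (@runs_prim I W nt (fun r : reads => (true,
    [ffun i => if i == ord0 then (r i, MoveLeft) else (mark, MoveRight)])) ts).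
exact: (runs_ite (b := true) r1).
Qed.

End Word.

Lemma tabulates_nothing (w : seq I) : tabulates w (fun _ _ _ => false) (padded Q w).
Proof.
split=> [k|q x y _ _]; first exact: padded_mark.
rewrite /padded; case: (_ + _) => //=.
by elim: w => [|c s IH] [|k] /=.
Qed.

End Initialization.

(** * Polynomial bounds *)

Section PolynomialTime.

Definition poly_bounded (T : nat -> nat) : Prop :=
  exists c d, forall k, T k <= c * k ^ d + c.

Lemma poly_bounded_const c : poly_bounded (fun=> c).
Proof. by exists c, 0 => k; rewrite leq_addl. Qed.

Lemma poly_bounded_id : poly_bounded id.
Proof. by exists 1, 1 => k; rewrite expn1 mul1n leq_addr. Qed.

(** The summand 1 is for [k = 0], where [0 ^ 0 = 1] exceeds [0 ^ e] for positive [e]. *)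
Lemma expn_le_sum k d e : d <= e -> k ^ d <= k ^ e + 1.
Proof.
case: k => [|k] de; first by case: d de => [|d] _; rewrite ?expn0 ?leq_addl // exp0n.
by rewrite (leq_trans (leq_pexp2l _ de)) ?leq_addr.
Qed.

Lemma poly_bounded_add T T' :
  poly_bounded T -> poly_bounded T' -> poly_bounded (fun k => T k + T' k).
Proof.
move=> [c [d H]] [c' [d' H']]; exists (2 * (c + c')), (maxn d d') => k.
have := expn_le_sum k (leq_maxl d d'); have := expn_le_sum k (leq_maxr d d').
move: (H k) (H' k); set x := k ^ d; set y := k ^ d'; set e := k ^ _; nia.
Qed.

Lemma poly_bounded_mul T T' :
  poly_bounded T -> poly_bounded T' -> poly_bounded (fun k => T k * T' k).
Proof.
(* The product is at most [c c' (x + 1) (y + 1)] with [x = k ^ d] and [y = k ^ d']. Both [x] and [y]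
   are at most [x y + 1], so [3 c c'] would already do. *)
move=> [c [d H]] [c' [d' H']]; exists (4 * (c * c')), (d + d') => k.
apply: leq_trans (leq_mul (H k) (H' k)) _.
have := expn_le_sum k (leq_addr d' d); have := expn_le_sum k (leq_addl d d').
rewrite !expnD; set x := k ^ d; set y := k ^ d'; nia.
Qed.

Lemma poly_bounded_succ T : poly_bounded T -> poly_bounded (fun k => (T k).+1).
Proof.
by move=> H; have := poly_bounded_add (poly_bounded_const 1) H.
Qed.

Lemma poly_bounded_time (I Q : finType) nt (p : prog I Q nt) :
  exists2 T, poly_bounded T & forall w, time w p <= T (size w).
Proof.
have go : exists2 T, poly_bounded T & forall w : seq I,
    goto_time w + (1 + (((size w).+1 * (size w).+2 + (size w).+1).+1 + 1)) <= T (size w).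
  exists (fun k => k.+1 * (1 + (k.+2 + (1 + k.+2))) + k.+1 +
    (k.+2 + (1 + k.+2) + (k.+1 + k.+1 + 1)) + (1 + ((k.+1 * k.+2 + k.+1).+1 + 1))) => //.
  by do ![apply: poly_bounded_add|apply: poly_bounded_mul|apply: poly_bounded_succ|
          apply: poly_bounded_id|apply: poly_bounded_const].
elim: p => [|P i|P i|q i a j b|q i a j b|p [T HT H]|p [T HT H] p' [T' HT' H']|i p [T HT H]] //=.
- by exists (fun=> 1) => //; apply: poly_bounded_const.
- by exists (fun=> 1) => //; apply: poly_bounded_const.
- by exists (fun=> 4) => //; apply: poly_bounded_const.
- exists (fun k => T k + 1); last by move=> w; rewrite leq_add2r.
  exact: poly_bounded_add HT (poly_bounded_const 1).
- exists (fun k => T k + (T' k + 1)); last by move=> w; rewrite !leq_add.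
  exact: poly_bounded_add HT (poly_bounded_add HT' (poly_bounded_const 1)).
- exists (fun k => k.+1 * (1 + (1 + (T k + 1))) + (1 + (k.+2 + 1))); last first.
    by move=> w; rewrite leq_add2r leq_mul2l !leq_add2l leq_add2r H orbT.
  by do ![apply: poly_bounded_add|apply: poly_bounded_mul|apply: poly_bounded_succ|
          apply: poly_bounded_id|apply: poly_bounded_const|exact: HT].
Qed.

End PolynomialTime.

(** Hands the problem over to the language: it remains to find a well-scoped program that decides
    [P] from an empty store. The factor 2 leaves room for the punctuation of the encoding. *)
Theorem prog_polytime (X : Type) (I Q : finType) nt (tb u z : 'I_nt.+1)
    (p : prog I Q nt) (enc : X -> seq I) (sz : X -> nat) (P : X -> Prop) :
  uniq [:: tb; u; z] -> well_scoped tb u z (fun=> false) p ->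
  (forall x, size (enc x) <= 2 * sz x) ->
  (forall x, (eval (enc x) p (fun=> 0) (fun _ _ _ => false)).1 <-> P x) ->
  polytime_decidable enc sz P.
Proof.
move=> U ws enc_sz evalP; have [T [c [d HT]] timeT] := poly_bounded_time p.
exists (machine_of (seqf (mark_others I Q nt) (seqf (prepare I Q nt) (compile tb u z p)))).
have [c' [d' B]] : poly_bounded (fun k => (2 * k).+1 + (2 * k).+4 + (c * (2 * k) ^ d + c)).
  have pw : poly_bounded (fun k => (2 * k) ^ d).
    elim: d {HT} => [|d IH]; first exact: poly_bounded_const.
    have H := poly_bounded_mul (poly_bounded_mul (poly_bounded_const 2) poly_bounded_id) IH.
    by case: H => c0 [d0 H]; exists c0, d0 => k; rewrite expnS.
  by do ![apply: poly_bounded_add|apply: poly_bounded_mul|apply: poly_bounded_succ|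
          apply: poly_bounded_id|apply: poly_bounded_const|exact: pw].
exists c', d' => x; exists (eval (enc x) p (fun=> 0) (fun _ _ _ => false)).1; split; last exact: evalP.
have [||B' _ D] := compile_correct U ws _ _ (tabulates_nothing Q (enc x)) (h := fun=> 0).
- by [].
- by move=> i; rewrite ltnn.
have [k [ts' [lek r]]] := initialized_run D.
apply: answer_machine_of r; apply: leq_trans lek _; apply: leq_trans (B (sz x)).
have le := enc_sz x; rewrite !leq_add ?ltnS //.
apply: leq_trans (timeT _) _; apply: leq_trans (HT _) _.
rewrite leq_add2r leq_mul2l; apply/orP; right.
by case: (d) => [|d1]; rewrite ?expn0 ?leq_exp2r.
Qed.

(** * Saturation under Horn rules *)

Section ProgramLogic.
Variables (I Q : finType) (nt : nat) (w : seq I).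
Notation tp := 'I_nt.+1.
Notation prog := (prog I Q nt).
Notation store := (store Q).
Notation n := (size w).
Notation eval := (@eval I Q nt w).
Implicit Types (p : prog) (h : tp -> nat) (X Y : store).

Definition holds p h X : bool := (eval p h X).1.

Definition substore X (C : Q -> nat -> nat -> Prop) : Prop :=
  forall q x y, X q x y -> C q x y.

Fixpoint pure p : bool :=
  match p with
  | Skip | Test _ _ | TestLeft _ _ | Look _ _ _ _ _ => true
  | Put _ _ _ _ _ => false
  | Neg p => pure p
  | And p p' => pure p && pure p'
  | All _ p => pure p
  end.

(** The guards of Horn rules: conjunctions of tests and lookups, hence monotone in the store. *)
Fixpoint positive p : bool :=
  match p with
  | Skip | Test _ _ | TestLeft _ _ | Look _ _ _ _ _ => true
  | And p p' => positive p && positive p'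
  | _ => false
  end.

Lemma positive_pure p : positive p -> pure p.
Proof. by elim: p => //= p IH p' IH' /andP[/IH -> /IH']. Qed.

Lemma pure_eval p h X : pure p -> eval p h X = (holds p h X, X).
Proof.
rewrite /holds; elim: p h X => //= [p IH|p IH p' IH'|i p IH] h X.
- by move=> pp; rewrite IH.
- by case/andP=> pp pp'; rewrite IH //=; case: (eval p h X).1; rewrite // IH'.
- move=> pp; elim: (iota 1 n) (true) => //= k s IHs [] /=; last by rewrite IHs.
  by rewrite IH //= IHs.
Qed.

Lemma holds_Neg p h X : holds (Neg p) h X = ~~ holds p h X.
Proof. by []. Qed.

Lemma holds_And p p' h X : pure p -> holds (And p p') h X = holds p h X && holds p' h X.
Proof. by move=> pp; rewrite /holds /= pure_eval //=; case: (holds p h X). Qed.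

Lemma holds_All i p h X : pure p ->
  holds (All i p) h X = all (fun k => holds p (upd h i k) X) (iota 1 n).
Proof.
move=> pp; rewrite /holds /=.
have -> : forall s b, foldl (fun (s : bool * store) k =>
    if s.1 then eval p (upd h i k) s.2 else s) (b, X) s =
    (b && all (fun k => (eval p (upd h i k) X).1) s, X).
  elim=> [|k s IH] [] //=; first by rewrite pure_eval //= IH.
by [].
Qed.

Lemma holds_AllP i p h X : pure p ->
  reflect (forall k, 0 < k <= n -> holds p (upd h i k) X) (holds (All i p) h X).
Proof.
move=> pp; rewrite holds_All //; apply: (iffP allP) => H k; last first.
  by rewrite mem_iota add1n ltnS => /H.
by move=> kn; apply: H; rewrite mem_iota add1n ltnS.
Qed.

Lemma positive_mono p h X Y : positive p -> substore X Y ->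
  holds p h X -> holds p h Y.
Proof.
move=> + XY; elim: p => //= [q i a j b _|p IH p' IH' /andP[pp pp']].
  exact: XY.
by rewrite !holds_And ?positive_pure // => /andP[/(IH pp) -> /(IH' pp')].
Qed.

Variables (tb au az : tp).
Notation well_scoped := (well_scoped tb au az).

(** Makes a closed program insensitive to the pointers of loops placed around it merely to repeat
    it. *)
Lemma eval_ext D p h h' X : well_scoped D p -> (forall i, D i -> h i = h' i) ->
  eval p h X = eval p h' X.
Proof.
elim: p D h h' X => /= [//|P i|P i|q i a j b|q i a j b|p IH|p IH p' IH'|i p IH] D h h' X.
- by move=> Di H; rewrite H.
- by move=> Di H; rewrite H.
- by case/andP=> Di Dj H; rewrite !H.
- by case/andP=> Di Dj H; rewrite !H.
- by move=> ws H; rewrite (IH _ _ _ _ ws H).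
- by case/andP=> ws ws' H; rewrite (IH _ _ _ _ ws H) (IH' _ _ _ _ ws' H).
- case/and3P=> _ _ ws H; elim: (iota 1 n) (true, X) => //= k s IHs st.
  have -> : eval p (upd h i k) st.2 = eval p (upd h' i k) st.2 => //.
  by apply: IH ws _ => j; rewrite /busy /upd; case: eqP => // _ /H.
Qed.

Definition Alls (s : seq tp) p : prog := foldr (fun i p => All i p) p s.

Fixpoint upds h (s : seq tp) (ks : seq nat) : tp -> nat :=
  match s, ks with
  | i :: s', k :: ks' => upds (upd h i k) s' ks'
  | _, _ => h
  end.

Definition in_word (ks : seq nat) : bool := all (fun k => 0 < k <= n) ks.

Lemma pure_Alls s p : pure (Alls s p) = pure p.
Proof. by elim: s. Qed.

Lemma holds_AllsP s p h X : pure p ->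
  holds (Alls s p) h X <->
  forall ks, size ks = size s -> in_word ks -> holds p (upds h s ks) X.
Proof.
move=> pp; elim: s h => [|i s IH] h /=.
  by split=> [H [|k ks]|/(_ [::] erefl isT)].
split=> [/holds_AllP H [|k ks] //= [E] /andP[kn ksn]|H].
  by move/(_ _ k kn): H; rewrite pure_Alls => /(_ pp) /IH; apply.
apply/holds_AllP; first by rewrite pure_Alls.
by move=> k kn; apply/IH => ks E ksn; apply: (H (k :: ks)); rewrite /= ?E ?kn.
Qed.

Definition conj (ps : seq prog) : prog := foldr (fun p p' => And p p') (Skip I Q nt) ps.

Lemma pure_conj ps : pure (conj ps) = all pure ps.
Proof. by elim: ps => //= p ps ->. Qed.

Lemma holds_conj ps h X : all pure ps ->
  holds (conj ps) h X = all (fun p => holds p h X) ps.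
Proof. by elim: ps => //= p ps IH /andP[pp pps]; rewrite holds_And // IH. Qed.

Definition update p : Prop :=
  forall h X, (eval p h X).1 = true /\ substore X (eval p h X).2.

Definition preserves (C : Q -> nat -> nat -> Prop) p h : Prop :=
  forall X, substore X C -> substore (eval p h X).2 C.

(** Quantified over all stores above [X0], because other facts may have been added by the time [p]
    is reached. *)
Definition ensures X0 p h q x y : Prop :=
  forall X, substore X0 X -> (eval p h X).2 q x y.

Lemma update_true h X p : update p -> eval p h X = (true, (eval p h X).2).
Proof. by move=> /(_ h X) [<- _]; case: (eval p h X). Qed.

Lemma update_All i p : update p -> update (All i p).
Proof.
move=> U h X /=; elim: (iota 1 n) X => [|k s IH] X; first by split.
rewrite /=.
rewrite (update_true _ _ U); have [H1 H2] := IH (eval p (upd h i k) X).2.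
by split=> // q x y Xq; apply: H2; have [_ ] := U (upd h i k) X; apply.
Qed.

Lemma update_And p p' : update p -> update p' -> update (And p p').
Proof.
move=> U U' h X /=; rewrite (update_true _ _ U) /=; have [H1 H2] := U' h (eval p h X).2.
by split=> // q x y Xq; apply: H2; have [_ ] := U h X; apply.
Qed.

Lemma preserves_All C i p h :
  (forall k, 0 < k <= n -> preserves C p (upd h i k)) -> preserves C (All i p) h.
Proof.
move=> H X XC /=.
have : forall k, k \in iota 1 n -> preserves C p (upd h i k).
  by move=> k; rewrite mem_iota add1n ltnS; apply: H.
elim: (iota 1 n) (true) X XC => //= k s IH [] X XC Hs; last first.
  by apply: IH => // j js; apply: Hs; rewrite inE js orbT.
case E: (eval p (upd h i k) X) => [b Y]; apply: IH => [|j js]; last first.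
  by apply: Hs; rewrite inE js orbT.
by have := Hs k (mem_head _ _) X XC; rewrite E.
Qed.

(** An update never fails, so round [k] is reached with a store still above [X0]; the later rounds
    keep what it adds. *)
Lemma ensures_All X0 i p h k q x y : update p -> 0 < k <= n ->
  ensures X0 p (upd h i k) q x y -> ensures X0 (All i p) h q x y.
Proof.
move=> U kn E X X0X /=.
have : k \in iota 1 n by rewrite mem_iota add1n ltnS.
elim: (iota 1 n) X X0X => //= j s IH X X0X.
rewrite (update_true _ _ U) inE => /predU1P[<-|ks].
  have /= : (eval p (upd h i k) X).2 q x y by apply: E.
  elim: s (eval p (upd h i k) X).2 {IH} => //= l s IH Y Yq.
  rewrite (update_true _ _ U); apply: IH => //.
  by have [_] := U (upd h i l) Y; apply.
apply: IH => // q' x' y' /X0X Xq; have [_] := U (upd h i j) X; exact.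
Qed.

Lemma preserves_Alls C s p h :
  (forall ks, size ks = size s -> in_word ks -> preserves C p (upds h s ks)) ->
  preserves C (Alls s p) h.
Proof.
elim: s h => [|i s IH] h H /=; first exact: (H [::]).
apply: preserves_All => k kn; apply: IH => ks E ksn.
by apply: (H (k :: ks)); rewrite /= ?E ?kn.
Qed.

Lemma update_Alls s p : update p -> update (Alls s p).
Proof. by move=> U; elim: s => //= i s IH; apply: update_All. Qed.

Lemma ensures_Alls X0 s p h ks q x y : update p -> size ks = size s -> in_word ks ->
  ensures X0 p (upds h s ks) q x y -> ensures X0 (Alls s p) h q x y.
Proof.
move=> U; elim: s h ks => [|i s IH] h [|k ks] //= [E] /andP[kn ksn] H.
by apply: (ensures_All _ kn (IH _ _ E ksn H)); apply: update_Alls.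
Qed.

Record rule := Rule {
  guard : prog;
  head_rel : Q; head_fst : tp; head_ofst : bool; head_snd : tp; head_osnd : bool
}.
Implicit Type r : rule.

Definition head_put r : prog :=
  Put _ (head_rel r) (head_fst r) (head_ofst r) (head_snd r) (head_osnd r).

Definition head_in r h (C : Q -> nat -> nat -> Prop) : Prop :=
  C (head_rel r) (h (head_fst r) + head_ofst r) (h (head_snd r) + head_osnd r).

(** A conditional without alternative. The answer is true whether or not the guard holds, so that
    the surrounding conjunction and loops go on. *)
Definition fire r : prog := Neg (And (guard r) (Neg (head_put r))).

Lemma eval_fire r h X : pure (guard r) ->
  eval (fire r) h X = (true, if holds (guard r) h X then (eval (head_put r) h X).2 else X).
Proof. by move=> pg; rewrite /= pure_eval //=; case: (holds _ _ _). Qed.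

Lemma substore_put X (C : Q -> nat -> nat -> Prop) q x y :
  substore X C -> C q x y -> substore (put X q x y) C.
Proof.
move=> XC Cq q' x' y'; rewrite /put => /orP[/and3P[/eqP-> /eqP-> /eqP->] //|].
exact: XC.
Qed.

Section Saturation.
Variables (rules : seq rule) (vars : seq tp).
Hypothesis rules_positive : forall r, List.In r rules -> positive (guard r).
Definition fire_all : prog := conj (map fire rules).
Definition pass : prog := Alls vars fire_all.

Lemma update_fire r : pure (guard r) -> update (fire r).
Proof.
move=> pg h X; rewrite eval_fire //; split=> // q x y Xq.
by case: ifP => //= _; rewrite /put Xq orbT.
Qed.

Lemma eval_fire_cons r rs h X : pure (guard r) ->
  eval (conj (map fire (r :: rs))) h X =
  eval (conj (map fire rs)) h (eval (fire r) h X).2.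
Proof.
move=> pg; transitivity (if (eval (fire r) h X).1
  then eval (conj (map fire rs)) h (eval (fire r) h X).2
  else (false, (eval (fire r) h X).2)) => //.
by rewrite eval_fire.
Qed.

Lemma update_fire_all rs : (forall r, List.In r rs -> positive (guard r)) ->
  update (conj (map fire rs)).
Proof.
elim: rs => [_|r rs IH H] /=; first by move=> h X; split.
apply: update_And; last by apply: IH => r' ?; apply: H; right.
by apply/update_fire/positive_pure/H; left.
Qed.

Lemma update_pass : update pass.
Proof. exact/update_Alls/update_fire_all. Qed.

(** Soundness of a pass, one rule instance at a time. The hypothesis covers every store within [C],
    since facts added earlier in the same pass may be used. *)
Lemma preserves_pass (C : Q -> nat -> nat -> Prop) h :
  (forall r ks X, List.In r rules -> size ks = size vars -> in_word ks ->
     substore X C -> holds (guard r) (upds h vars ks) X ->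
     head_in r (upds h vars ks) C) ->
  preserves C pass h.
Proof.
move=> H; apply: preserves_Alls => ks E ksn.
have {}H : forall r X, List.In r rules -> substore X C -> holds (guard r) (upds h vars ks) X ->
     head_in r (upds h vars ks) C by move=> r X rin; apply: H.
rewrite /fire_all; elim: (rules) rules_positive H => [|r rs IH] pos H X XC //.
have pg : pure (guard r) by apply/positive_pure/pos; left.
rewrite eval_fire_cons //.
apply: IH => [r' ?|r' Y r'in|]; [by apply: pos; right|by apply: H; right|].
rewrite eval_fire //=; case: ifP => // gd; apply: substore_put => //.
by apply: (H r X); [left| |].
Qed.

(** A guard that holds before the pass still holds when its instance is reached: it is positive and
    the store only grows. *)
Lemma ensures_pass X r h ks : List.In r rules -> size ks = size vars -> in_word ks ->
  holds (guard r) (upds h vars ks) X ->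
  (eval pass h X).2 (head_rel r) (upds h vars ks (head_fst r) + head_ofst r)
    (upds h vars ks (head_snd r) + head_osnd r).
Proof.
move=> rin E ksn gd; set g := upds h vars ks in gd *.
suff : ensures X pass h (head_rel r) (g (head_fst r) + head_ofst r) (g (head_snd r) + head_osnd r).
  exact.
apply: ensures_Alls (E) ksn _; first exact: update_fire_all.
rewrite -/g /fire_all; elim: (rules) rules_positive rin => [|r' rs IH] pos rin Y XY //.
have pg : pure (guard r') by apply/positive_pure/pos; left.
rewrite eval_fire_cons //.
have U : update (conj (map fire rs)) by apply: update_fire_all => r1 ?; apply: pos; right.
case: rin => [er|rin].
  have [_] := U g (eval (fire r') g Y).2; apply.
  rewrite er eval_fire ?(positive_mono _ XY gd) //=; first by rewrite /put !eqxx.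
    by rewrite -er; apply: pos; left.
  by rewrite -er.
apply: (IH _ rin) => [r1 ?|q x y /XY Yq]; first by apply: pos; right.
by have [_] := update_fire pg g Y; apply.
Qed.

Hypothesis pass_scoped : well_scoped (fun=> false) pass.

(** [d1] and [d2] only count: two nested loops repeat the pass [n ^ 2] times, and [c] copies of them
    give [c * n ^ 2] passes. *)
Definition iterated (d1 d2 : tp) (c : nat) : prog :=
  conj (nseq c (All d1 (All d2 pass))).

Notation pass_step := (fun X => (eval pass (fun=> 0) X).2).

Lemma eval_pass h X : eval pass h X = (true, pass_step X).
Proof. by rewrite (eval_ext (h' := fun=> 0) _ pass_scoped) // (update_true _ _ update_pass). Qed.

Lemma eval_iterated d1 d2 c h X :
  eval (iterated d1 d2 c) h X = (true, iter (c * (n * n)) pass_step X).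
Proof.
have iter_All i p m : (forall h X, eval p h X = (true, iter m pass_step X)) ->
    forall h X, eval (All i p) h X = (true, iter (n * m) pass_step X).
  move=> H h' Y; rewrite /=.
  have -> : forall s Z, foldl (fun (s : bool * store) k =>
      if s.1 then eval p (upd h' i k) s.2 else s) (true, Z) s =
      (true, iter (size s * m) pass_step Z).
    elim=> //= k s IH Z; rewrite H IH -iterD; congr (true, iter _ _ _).
    by rewrite mulSn addnC.
  by rewrite size_iota.
have HA h' Y : eval (All d1 (All d2 pass)) h' Y = (true, iter (n * (n * 1)) pass_step Y).
  by apply: (iter_All) => {}h' {}Y; apply: (iter_All) => {}h' {}Y; apply: eval_pass.
elim: c h X => // c IH h X.
rewrite [LHS](_ : _ = if (eval (All d1 (All d2 pass)) h X).1
  then eval (iterated d1 d2 c) h (eval (All d1 (All d2 pass)) h X).2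
  else (false, (eval (All d1 (All d2 pass)) h X).2)) //.
by rewrite HA IH -iterD muln1 mulSn addnC.
Qed.

Definition within_range (C : Q -> nat -> nat -> Prop) : Prop :=
  forall q x y, C q x y -> x < n.+2 /\ y < n.+2.

(* Every pass that is not a fixed point adds one of the |Q| (n + 2)^2 facts. *)
Lemma iter_pass_stable (C : Q -> nat -> nat -> Prop) N X :
  preserves C pass (fun=> 0) -> within_range C -> substore X C ->
  #|Q| * (n.+2 * n.+2) <= N -> pass_step (iter N pass_step X) = iter N pass_step X.
Proof.
move=> PC RC XC leN.
have iterC k : substore (iter k pass_step X) C by elim: k => //= k /PC.
pose facts Y := [pred t : Q * ('I_n.+2 * 'I_n.+2) | Y t.1 (val t.2.1) (val t.2.2)].
have grow Y : substore Y C -> pass_step Y = Y \/ #|facts Y| < #|facts (pass_step Y)|.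
  move=> YC; have [H|H] := pselect (substore (pass_step Y) Y).
    left; apply: funext => q; apply: funext => x; apply: funext => y.
    apply/idP/idP; first exact: H.
    by have [_] := update_pass (fun=> 0) Y; apply.
  right; apply: proper_card; apply/properP; split.
    apply/fintype.subsetP => -[q [x y]]; rewrite !inE /=.
    by have [_] := update_pass (fun=> 0) Y; apply.
  move/existsNP: H => [q /existsNP[x /existsNP[y /not_implyP[H1 H2]]]].
  have [xn yn] := RC _ _ _ (PC Y YC _ _ _ H1).
  by exists (q, (Ordinal xn, Ordinal yn)); rewrite ?inE //=; apply/negP.
have stable_or k : pass_step (iter k pass_step X) = iter k pass_step X \/
    k < #|facts (iter k.+1 pass_step X)|.
  elim: k => [|k IH]; first by case: (grow X XC) => [|H]; [left|right; apply: leq_ltn_trans H].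
  case: IH => [H|H]; first by left; rewrite [iter k.+1 _ _]/= !H.
  by case: (grow _ (iterC k.+1)) => [|H']; [left|right; apply: leq_ltn_trans H'].
case: (stable_or N) => // /leq_trans /(_ (max_card _)).
by rewrite !card_prod !card_ord ltnNge leN.
Qed.

(** One more pass would add the head of any rule whose guard holds; at a fixed point it is there
    already. *)
Lemma iter_pass_closed N X r ks :
  pass_step (iter N pass_step X) = iter N pass_step X ->
  List.In r rules -> size ks = size vars -> in_word ks ->
  let h := upds (fun=> 0) vars ks in
  holds (guard r) h (iter N pass_step X) -> head_in r h (iter N pass_step X).
Proof.
by move=> E rin Eks ksn h gd; rewrite /head_in -E; apply: ensures_pass.
Qed.

End Saturation.
End ProgramLogic.

(** * Finite quotients of the term algebra *)

Section TermAlgebra.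
Variable S : signature.
Implicit Types (p q s t : term S) (G : seq (term S * term S)).

(** Structural induction with a hypothesis for every argument [a i], reached through the finite
    function nested in [App]. *)
Fixpoint term_rect_ffun (P : term S -> Prop)
  (H : forall f (a : {ffun 'I_(arity f) -> term S}), (forall i, P (a i)) -> P (App a)) t : P t :=
  let: App f a := t in H f a (fun i => term_rect_ffun H (a i)).

Definition head_symbol t : S := let: App f _ := t in f.

(** The type of the arguments depends on the symbol, so [App] is read as a dependent pair; decidable
    equality of symbols then allows its second component to be compared. *)
Lemma App_inj (f : S) : injective (@App S f).
Proof.
pose T (g : S) := {ffun 'I_(arity g) -> term S}.
pose tagged_args t : {g : S & T g} := let: App g c := t in Tagged T c.
by move=> a b /(congr1 tagged_args) E; apply: (@eq_from_Tagged _ T f).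
Qed.

Lemma eqv_congruence G : is_congruence (eqv G).
Proof.
split=> [t|t u H|t u v H H'|f a b H] r rC rG.
- exact: congr_refl.
- by apply: (congr_sym rC); apply: H.
- by apply: (congr_trans rC) (H r rC rG) (H' r rC rG).
- by apply: (congr_App rC) => i; apply: H.
Qed.

Lemma eqv_class_eq G s t : eqv_class G s = eqv_class G t <-> eqv G s t.
Proof.
have C := eqv_congruence G; split=> [E|st].
  by have : eqv_class G t t := congr_refl C t; rewrite -E.
apply/seteqP; split=> u; apply: (congr_trans C) => //.
exact: (congr_sym C).
Qed.

(** * The partial algebra of occurrences and its free extension *)

Section OccurrenceGraph.
(** Nodes are abstract here; later they are word positions and [K] is read off the saturated table.
    [K] is assumed sound and closed under the congruence rules on nodes. *)
Variables (G : seq (term S * term S)) (N : Type).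
Variables (occ : N -> term S -> Prop) (child : N -> nat -> N -> Prop) (K : N -> N -> Prop).
Hypothesis occ_inj : forall x s t, occ x s -> occ x t -> s = t.
Hypothesis child_ex : forall x f (a : {ffun 'I_(arity f) -> term S}) (i : 'I_(arity f)),
  occ x (App a) -> exists y, child x i y.
Hypothesis child_occ : forall x f (a : {ffun 'I_(arity f) -> term S}) (i : 'I_(arity f)) y,
  occ x (App a) -> child x i y -> occ y (a i).
Hypothesis K_sound : forall x y, K x y -> exists s t, [/\ occ x s, occ y t & eqv G s t].
Hypothesis K_refl : forall x t, occ x t -> K x x.
Hypothesis K_sym : forall x y, K x y -> K y x.
Hypothesis K_trans : forall x y v, K x y -> K y v -> K x v.
Hypothesis K_eqs : forall s t, List.In (s, t) G -> exists x y, [/\ occ x s, occ y t & K x y].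
Hypothesis K_App : forall x y f (a b : {ffun 'I_(arity f) -> term S}),
  occ x (App a) -> occ y (App b) ->
  (forall i : 'I_(arity f), exists u v, [/\ child x i u, child y i v & K u v]) -> K x y.

(** A relation instead of a function: the value of a term is a class of [K], represented by any of
    its nodes. *)
Fixpoint evaluates (t : term S) (x : N) : Prop :=
  let: App f a := t in
  exists y (b : {ffun 'I_(arity f) -> term S}) (c : 'I_(arity f) -> N),
    [/\ occ y (App b), forall i : 'I_(arity f), child y i (c i), forall i, evaluates (a i) (c i) & K y x].

Definition defined t : Prop := exists x, evaluates t x.

Lemma occ_evaluates x t : occ x t -> evaluates t x.
Proof.
elim/term_rect_ffun: t x => f a IH x ox.
have /choice [c Hc] : forall i : 'I_(arity f), exists y, child x i y.
  by move=> i; apply: child_ex ox.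
exists x, a, c; split=> // [i|]; last exact: K_refl ox.
by apply: IH; apply: child_occ ox (Hc i).
Qed.

Lemma evaluates_K t x y : evaluates t x -> K x y -> evaluates t y.
Proof.
case: t => f a [v [b [c [ov Hc Ec Kv]]]] Kxy.
by exists v, b, c; split=> //; apply: K_trans Kxy.
Qed.

(** By induction the arguments have congruent values, and [K_App] carries this over to the two
    occurrences of the head symbol. *)
Lemma evaluates_fun t x y : evaluates t x -> evaluates t y -> K x y.
Proof.
elim/term_rect_ffun: t x y => f a IH x y [v [b [c [ov Hc Ec Kv]]]] [v' [b' [c' [ov' Hc' Ec' Kv']]]].
apply: (K_trans (K_sym Kv)); apply: K_trans Kv'; apply: K_App ov ov' _ => i.
by exists (c i), (c' i); split=> //; apply: IH (Ec i) (Ec' i).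
Qed.

Lemma evaluates_eqv t x s : evaluates t x -> occ x s -> eqv G t s.
Proof.
have C := eqv_congruence G.
elim/term_rect_ffun: t x s => f a IH x s [y [b [c [oy Hc Ec Ky]]]] os.
have ab : eqv G (App a) (App b).
  by apply: (congr_App C) => i; apply: IH (Ec i) _; apply: child_occ oy (Hc i).
apply: (congr_trans C ab).
by have [s1 [t1 [o1 o2]]] := K_sound Ky; rewrite (occ_inj o1 oy) (occ_inj o2 os).
Qed.

(* The terms without a value form an absolutely free extension of the partial
   algebra of nodes, so they are only identified argumentwise. *)
Fixpoint free_eq (p q : term S) : Prop :=
  (exists x, evaluates p x /\ evaluates q x) \/
  let: App f a := p in
  [/\ ~ defined (App a), ~ defined q &
    exists2 b : {ffun 'I_(arity f) -> term S}, q = App b & forall i, free_eq (a i) (b i)].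

Lemma free_eq_evaluates p q x : free_eq p q -> evaluates p x -> evaluates q x.
Proof.
case: p => f a [[y [Ep Eq]]|[ND _ _]] E; last by case: ND; exists x.
by apply: evaluates_K Eq _; apply: evaluates_fun E.
Qed.

Lemma free_eq_sym p q : free_eq p q -> free_eq q p.
Proof.
elim/term_rect_ffun: p q => f a IH q [[y [Ep Eq]]|[ND ND' [b eq H]]].
  by case: q Eq => g b Eq; left; exists y.
subst q; right=> /=; split=> //; exists a => // i; exact: IH (H i).
Qed.

Lemma free_eq_congruence : is_congruence free_eq.
Proof.
split=> [t|||f a b H]; last 1 first.
(* Related arguments have the same values, so a value of [App c] is one of [App d]; hence both sides
   are defined or neither is. *)
- have L (c d : {ffun 'I_(arity f) -> term S}) x : (forall i, free_eq (c i) (d i)) ->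
      evaluates (App c) x -> evaluates (App d) x.
    move=> cd [y [e [k [oy Hk Ek Ky]]]]; exists y, e, k; split=> // i.
    exact: free_eq_evaluates (cd i) (Ek i).
  have [[x E]|ND] := pselect (defined (App a)).
    by left; exists x; split=> //; apply: L E.
  right=> /=; split=> // [[x E]|]; last by exists b.
  by apply: ND; exists x; apply: L E => i; apply: free_eq_sym.
- elim/term_rect_ffun: t => f a IH.
  have [[x E]|ND] := pselect (defined (App a)); first by left; exists x.
  by right=> /=; split=> //; exists a.
- exact: free_eq_sym.
- move=> p; elim/term_rect_ffun: p => f a IH q v [[x [Ep Eq]]|[ND ND' [b eq H]]] qv.
    by left; exists x; split=> //; apply: free_eq_evaluates qv Eq.
  subst q; case: qv => [[x [Eb _]]|[_ NDv [c ev H']]]; first by case: ND'; exists x.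
  by right=> /=; split=> //; exists c => // i; exact: IH (H i) (H' i).
Qed.

(** Minimality of [eqv]: the two sides of an equation occur as nodes, hence have values, and [K_eqs]
    relates these. *)
Lemma eqv_free_eq p q : eqv G p q -> free_eq p q.
Proof.
move/(_ _ free_eq_congruence); apply=> s t /K_eqs [x [y [os ot Kxy]]].
have Et := occ_evaluates ot; have Es := evaluates_K (occ_evaluates os) Kxy.
by case: s Es {os} => f a Es; left; exists y.
Qed.

(** Totality of the operations on classes of nodes. For a constant symbol it says that the symbol
    occurs in the equations. *)
Definition closed_nodes : Prop :=
  forall f (x : 'I_(arity f) -> N), (forall i, exists t, occ (x i) t) ->
  exists y (b : {ffun 'I_(arity f) -> term S}),
    occ y (App b) /\ forall i : 'I_(arity f), exists2 u, child y i u & K u (x i).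

Lemma closed_defined t : closed_nodes -> defined t.
Proof.
move=> H; elim/term_rect_ffun: t => f a /choice [x Ex].
have K_occ u v : K u v -> exists t, occ v t by move=> /K_sound [_ [t [_ o _]]]; exists t.
have [|y [b [oy Hy]]] := H f x.
  move=> i; move: (Ex i); case: (a i) => g c [v [_ [_ [_ _ _ /K_occ //]]]].
have /choice [c Hc] : forall i : 'I_(arity f), exists u, child y i u /\ K u (x i).
  by move=> i; have [u] := Hy i; exists u.
exists y, y, b, c; split=> // [i|i|]; last exact: K_refl oy.
  by have [] := Hc i.
by apply: evaluates_K (Ex i) _; apply: K_sym; have [] := Hc i.
Qed.

Lemma infinite_injection (T : Type) (A : set T) (b : nat -> T) :
  injective b -> (forall k, A (b k)) -> ~ finite_set A.
Proof.
move=> binj bA finA; apply: infinite_nat.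
have -> : setT = (b @^-1` A)%classic by apply/seteqP; split=> // k _; apply: bA.
by apply: finite_preimage => // j k _ _; apply: binj.
Qed.

Lemma finite_quotient_closed (g : S) : 0 < arity g ->
  finite_set (quotient_carrier G) -> closed_nodes.
Proof.
move=> g0; apply: contraPP => /existsNP [f] /existsNP [x] /not_implyP [/choice [a oa] Hx].
pose t0 := App [ffun i => a i].
pose b k := iter k (fun t => @App S g [ffun=> t]) t0.
have Nt0 : ~ defined t0.
  move=> [v [y [d [c [oy Hc Ec _]]]]]; apply: Hx; exists y, d; split=> // i.
  exists (c i) => //; apply: (@evaluates_fun (a i)); last exact: occ_evaluates.
  by have := Ec i; rewrite ffunE.
have Nb k : ~ defined (b k).
  elim: k => [//|k IH [v [y [d [c [_ _ Ec _]]]]]]; apply: IH; exists (c (Ordinal g0)).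
  by have := Ec (Ordinal g0); rewrite ffunE.
(* If [g] is [f], head symbols do not separate the two terms, but arguments do: those of [t0] are
   occurrences and have values, while [b k] has none. *)
have b0S k : ~ free_eq (b 0) (b k.+1).
  case=> [[y [Ey _]]|[_ _ [d E H]]]; first by apply: (Nb 0); exists y.
  have e : g = f := congr1 head_symbol E.
  subst g; move/App_inj: E => E.
  have := H (Ordinal g0); rewrite -E !ffunE => /free_eq_evaluates L.
  apply: (Nb k); exists (x (Ordinal g0)); apply: L.
  exact: occ_evaluates.
have binj j k : free_eq (b j) (b k) -> j = k.
  elim: j k => [|j IH] [|k] // H; first by have := b0S _ H.
    by have := b0S _ (free_eq_sym H).
  case: H => [[y [Ey _]]|[_ _ [d E H]]]; first by case: (Nb j.+1); exists y.
  move/App_inj: E => E; have := H (Ordinal g0); rewrite -E !ffunE => /IH -> //.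
apply: (@infinite_injection _ _ (fun k => eqv_class G (b k))).
  by move=> j k /eqv_class_eq /eqv_free_eq /binj.
by move=> k; exists (b k).
Qed.

(** Every term has a value, and a class is exactly the set of terms evaluating to a given node, so
    there are no more classes than nodes. *)
Lemma closed_finite_quotient (D : set N) : finite_set D ->
  (forall x t, occ x t -> D x) -> closed_nodes -> finite_set (quotient_carrier G).
Proof.
move=> finD occD H; pose F x : set (term S) := [set u | evaluates u x]%classic.
apply: sub_finite_set (finite_image F finD) => _ [t _ <-].
have [x Ex] := closed_defined t H.
have [s ox] : exists s, occ x s.
  by case: t Ex => f a [y [_ [_ [_ _ _ /K_sound [_ [s [_ o _]]]]]]]; exists s.
exists x; first exact: occD ox.
apply/seteqP; split=> u /=; rewrite /F /eqv_class /=.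
  move=> Eu; have C := eqv_congruence G.
  apply: (congr_trans C) (evaluates_eqv Ex ox) _.
  by apply: (congr_sym C); apply: evaluates_eqv Eu ox.
by move/eqv_free_eq/free_eq_evaluates; apply.
Qed.

End OccurrenceGraph.
End TermAlgebra.

(** * Polish notation *)

Section Words.
Variable S : signature.
Implicit Types (s t : term S) (l : seq (term S)) (v w : seq (token S)).
Notation tw := (@term_word S).

Definition forest_word l : seq (token S) := flatten (map tw l).
Definition subterms (f : S) (a : {ffun 'I_(arity f) -> term S}) : seq (term S) :=
  [seq a i | i <- enum 'I_(arity f)].

Lemma term_wordE (f : S) (a : {ffun 'I_(arity f) -> term S}) :
  tw (App a) = sym_tok f :: forest_word (subterms a).
Proof. by rewrite /= /forest_word /subterms -map_comp. Qed.

Lemma size_subterms (f : S) (a : {ffun 'I_(arity f) -> term S}) : size (subterms a) = arity f.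
Proof. by rewrite size_map size_enum_ord. Qed.

Lemma forest_word_cons t l : forest_word (t :: l) = tw t ++ forest_word l.
Proof. by []. Qed.

Lemma forest_word_cat l l' : forest_word (l ++ l') = forest_word l ++ forest_word l'.
Proof. by rewrite /forest_word map_cat flatten_cat. Qed.

Lemma subterms_split (f : S) (a : {ffun 'I_(arity f) -> term S}) (i : 'I_(arity f)) :
  subterms a = take i (subterms a) ++ a i :: drop i.+1 (subterms a).
Proof.
have ia : i < size (subterms a) by rewrite size_subterms.
rewrite -{1}(cat_take_drop i (subterms a)); congr cat.
rewrite (drop_nth (a i)) //; congr cons.
by rewrite (nth_map i) ?size_enum_ord // nth_ord_enum.
Qed.

(** Unique readability: the head symbol fixes the number of arguments, which are then split off one
    after the other. The remainders [v] and [v'] make the induction run along a list of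
    arguments. *)
Lemma term_word_inj s t v v' : tw s ++ v = tw t ++ v' -> s = t /\ v = v'.
Proof.
elim/term_rect_ffun: s t v v' => f a IH [g b] v v'; rewrite !term_wordE !cat_cons.
case=> e; subst g => E.
have {IH} IH l : (forall x, List.In x l -> exists i, x = a i) -> forall l' u u',
    size l = size l' -> forest_word l ++ u = forest_word l' ++ u' -> l = l' /\ u = u'.
  elim: l => [|x l IHl] Hl [|y l'] u u' //= [El].
  rewrite !forest_word_cons -!catA; have [i ->] := Hl x (or_introl erefl).
  case/IH=> <- /IHl [|//|-> ->] // z zl; by apply: Hl; right.
have [||E1 ->] := IH (subterms a) _ (subterms b) v v' _ E; last 1 first.
- split=> //; congr App; apply/ffunP => i.
  have nthE (c : {ffun 'I_(arity f) -> term S}) : nth (a i) (subterms c) i = c i.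
    by rewrite /subterms (nth_map i) ?size_enum_ord // nth_ord_enum.
  by rewrite -nthE E1 nthE.
- move=> x; rewrite /subterms; elim: (enum _) => //= i r IHr [<-|/IHr //].
  by exists i.
- by rewrite !size_subterms.
Qed.

Lemma forest_word_inj l l' v v' : size l = size l' ->
  forest_word l ++ v = forest_word l' ++ v' -> l = l' /\ v = v'.
Proof.
elim: l l' => [|x l IH] [|y l'] //= [E]; rewrite !forest_word_cons -!catA.
by case/term_word_inj => -> /(IH _ E) [-> ->].
Qed.

(** Each letter of a term in prefix notation is the head of the subterm written from there on. This
    is why symbol positions can stand for occurrences. *)
Lemma drop_term_word t v k : k < size (tw t) ->
  exists s v', drop k (tw t ++ v) = tw s ++ v'.
Proof.
elim/term_rect_ffun: t v k => f a IH v [|k]; first by exists (App a), v; rewrite drop0.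
rewrite term_wordE /= ltnS.
have {IH} : forall x, List.In x (subterms a) -> forall u j, j < size (tw x) ->
    exists s u', drop j (tw x ++ u) = tw s ++ u'.
  by move=> x; rewrite /subterms; elim: (enum _) => //= i r IHr [<- u j|/IHr //]; apply: IH.
elim: (subterms a) k => [|x l IHl] k H; first by rewrite ltn0.
rewrite forest_word_cons size_cat -catA; case: (ltnP k (size (tw x))) => kx.
  by move=> _; apply: H kx; left.
move=> kl; rewrite drop_cat ltnNge kx /=; apply: IHl => [y ly|]; last by rewrite ltn_subLR.
by apply: H; right.
Qed.

Variable w : seq (token S).

(** Positions 0 and 1 give the same tail, hence the conditions [0 < x] below. *)
Definition tail_at (x : nat) : seq (token S) := drop x.-1 w.

(* Positions in the word are counted from 1, as on the tapes. *)
Definition occ (x : nat) (t : term S) : Prop :=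
  0 < x /\ exists v, tail_at x = tw t ++ v.

Definition spans (m x y : nat) : Prop :=
  0 < x /\ exists l v,
    [/\ size l = m, tail_at x = forest_word l ++ v & y = x + size (forest_word l)].

(** Arguments are numbered from 0: argument [i] starts where the first [i] terms after the head
    symbol end. *)
Definition child (x i y : nat) : Prop := spans i x.+1 y.

Lemma tail_at_add x k v v' : 0 < x -> tail_at x = v ++ v' -> size v = k -> tail_at (x + k) = v'.
Proof.
case: x => // x _; rewrite /tail_at addSn /= addnC -drop_drop => -> <-.
by rewrite drop_size_cat.
Qed.

Lemma occ_inj x s t : occ x s -> occ x t -> s = t.
Proof. by move=> [_ [v E]] [_ [v']]; rewrite E => /term_word_inj []. Qed.

Lemma spans_tail_at m x y l v : spans m x y -> size l = m -> tail_at x = forest_word l ++ v ->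
  y = x + size (forest_word l) /\ tail_at y = v.
Proof.
move=> [x0 [l' [v' [<- E ->]]]] sl; rewrite E => /forest_word_inj -/(_ (esym sl)) [e e'].
by subst l' v'; split=> //; apply: tail_at_add E _.
Qed.

Lemma occ_args x f (a : {ffun 'I_(arity f) -> term S}) : occ x (App a) ->
  exists v, tail_at x.+1 = forest_word (subterms a) ++ v.
Proof.
move=> [x0 [v]]; rewrite term_wordE -[_ :: _]cat1s -catA => E; exists v.
by rewrite -addn1; apply: tail_at_add E _.
Qed.

Lemma child_ex x f (a : {ffun 'I_(arity f) -> term S}) (i : 'I_(arity f)) :
  occ x (App a) -> exists y, child x i y.
Proof.
move=> /occ_args [v]; rewrite (subterms_split a i) forest_word_cat -catA => E.
eexists; split=> //; exists (take i (subterms a)); eexists; split; [|exact: E|reflexivity].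
by rewrite size_takel // size_subterms ltnW.
Qed.

Lemma child_occ x f (a : {ffun 'I_(arity f) -> term S}) (i : 'I_(arity f)) y :
  occ x (App a) -> child x i y -> occ y (a i).
Proof.
move=> /occ_args [v]; rewrite (subterms_split a i) forest_word_cat -catA => E H.
have si : size (take i (subterms a)) = i by rewrite size_takel // size_subterms ltnW.
have [-> E'] := spans_tail_at H si E; split=> //.
by exists (forest_word (drop i.+1 (subterms a)) ++ v); rewrite E' forest_word_cons -catA.
Qed.

Lemma spans0 x : 0 < x -> spans 0 x x.
Proof. by move=> x0; split=> //; exists [::], (tail_at x); rewrite addn0. Qed.

Lemma spans_cat m m' x u y : spans m x u -> spans m' u y -> spans (m + m') x y.
Proof.
move=> [x0 [l [v [<- E ->]]]] [_ [l' [v' [<- E' ->]]]]; split=> //.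
exists (l ++ l'), v'; rewrite size_cat forest_word_cat size_cat addnA; split=> //.
by rewrite -catA -E' (tail_at_add x0 E).
Qed.

Lemma occ_spans x t y : occ x t -> spans 1 x y <-> y = x + size (tw t).
Proof.
move=> [x0 [v E]]; split=> [H|->].
  have [|-> _] := spans_tail_at (l := [:: t]) (v := v) H erefl; rewrite /forest_word /= cats0 //.
by split=> //; exists [:: t], v; rewrite /forest_word /= cats0.
Qed.

Lemma spans1_occ x y : spans 1 x y -> exists t, occ x t /\ y = x + size (tw t).
Proof.
move=> [x0 [[|t [|t' l]] [v [sl E ->]]]] //; move: E; rewrite /forest_word /= cats0 => E.
by exists t; split=> //; split=> //; exists v.
Qed.

Lemma tail_at_le x (c : token S) v : 0 < x -> tail_at x = c :: v -> x <= size w.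
Proof.
case: x => //= x _; rewrite /tail_at /= => E.
by rewrite ltnNge; apply/negP => le; rewrite drop_oversize in E.
Qed.

Lemma occ_le x t : occ x t -> 0 < x <= size w.
Proof.
case: t => f a [x0 [v]]; rewrite term_wordE cat_cons => E.
by rewrite x0 (tail_at_le x0 E).
Qed.

Lemma padded_tail_at (Q : finType) x (c : token S) : 0 < x ->
  (padded Q w x == Some (inl c)) = (ohead (tail_at x) == Some c).
Proof.
case: x => // x _; rewrite /padded /tail_at /=.
by elim: w x => [|b v IH] [|x] //=.
Qed.

End Words.

(** * The word that encodes a list of equations *)

Section EquationWord.
Variable S : signature.
Implicit Types (s t : term S) (G : seq (term S * term S)).
Notation tw := (@term_word S).

Lemma eqs_word_cons e G :
  eqs_word (e :: G) = tw e.1 ++ eq_tok S :: tw e.2 ++ end_tok S :: eqs_word G.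
Proof. by rewrite /eqs_word /= -catA cat_cons cat_rcons. Qed.

Lemma size_term_word t : size (tw t) = Defs.tsize t.
Proof.
elim/term_rect_ffun: t => f a IH; rewrite term_wordE /= /forest_word /subterms size_flatten.
rewrite /shape -map_comp -map_comp sumnE big_map big_enum /=; congr _.+1.
exact: eq_bigr.
Qed.

(** Each equation adds two punctuation marks, which its two sides, of size at least 1 each, pay
    for. *)
Lemma size_eqs_word G : size (eqs_word G) <= 2 * eqs_size G.
Proof.
elim: G => [|e G IH] //; rewrite eqs_word_cons /eqs_size big_cons -/(eqs_size G).
rewrite !(size_cat, size_term_word) /= !(size_cat, size_term_word) /=.
have pos t : 0 < Defs.tsize t by case: t.
move: (pos e.1) (pos e.2) IH; move: (Defs.tsize _) (Defs.tsize _) (size _) (eqs_size _).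
by move=> a b c d; lia.
Qed.

Lemma drop_symbol G k f v : drop k (eqs_word G) = sym_tok f :: v ->
  exists s v', drop k (eqs_word G) = tw s ++ v'.
Proof.
elim: G k => [|e G IH] k //; rewrite eqs_word_cons.
case: (ltnP k (size (tw e.1))) => k1; first by move=> _; apply: drop_term_word.
rewrite drop_cat ltnNge k1 /=; case: (k - _) => [|j] //=.
case: (ltnP j (size (tw e.2))) => k2; first by move=> _; apply: drop_term_word.
by rewrite drop_cat ltnNge k2 /=; case: (j - _) => [|i] //=; apply: IH.
Qed.

Lemma no_end_term t : all (predC1 (end_tok S)) (tw t).
Proof.
elim/term_rect_ffun: t => f a IH; rewrite term_wordE /= /forest_word /subterms.
by elim: (enum _) => //= i r IHr; rewrite all_cat IH.
Qed.

(** Offsets from 0 at which an equation may start. The last argument of a left-hand side is also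
    followed by the equality mark; only the end mark, or the start of the word, tells the whole side
    from it. *)
Definition boundary (v : seq (token S)) k : bool :=
  (k == 0) || (ohead (drop k.-1 v) == Some (end_tok S)).

Lemma boundary_cat u v k : all (predC1 (end_tok S)) u -> 0 < k ->
  boundary (rcons u (end_tok S) ++ v) k ->
  exists j, k = size (rcons u (end_tok S)) + j /\ boundary v j.
Proof.
case: k => // k; rewrite /boundary /= => nu _.
case: (ltngtP k (size u)) => [ku|ku|->].
- rewrite cat_rcons drop_cat ku (drop_nth (end_tok S)) //= => /eqP[E].
  by have := all_nthP (end_tok S) nu k ku; rewrite E inE eqxx.
- rewrite drop_cat size_rcons ltnNge ku /= => E; exists (k - size u); split.
    by rewrite addSn subnKC // ltnW.
  by rewrite subnS in E; rewrite E orbT.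
- by move=> _; exists 0; rewrite size_rcons addn0.
Qed.

Lemma boundary_cat_r u v j : boundary v j ->
  boundary (rcons u (end_tok S) ++ v) (size (rcons u (end_tok S)) + j).
Proof.
rewrite /boundary size_rcons; case: j => [|j] /= H.
  by rewrite addn0 cat_rcons drop_size_cat.
by rewrite drop_cat size_rcons ltnNge addnS leq_addr /= -addSn addKn.
Qed.

Lemma eqs_word_rcons e G :
  eqs_word (e :: G) = rcons (tw e.1 ++ eq_tok S :: tw e.2) (end_tok S) ++ eqs_word G.
Proof. by rewrite eqs_word_cons cat_rcons -catA. Qed.

Lemma equation_at_boundary G s k v : boundary (eqs_word G) k ->
  drop k (eqs_word G) = tw s ++ eq_tok S :: v ->
  exists t v', List.In (s, t) G /\ v = tw t ++ v'.
Proof.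
elim: G k => [|[p q] G IH] k Bk; first by case: s => f a; rewrite term_wordE.
case: k Bk => [|k] Bk.
  rewrite eqs_word_cons drop0 => /term_word_inj [<- [<-]].
  by exists q, (end_tok S :: eqs_word G); split=> //; left.
rewrite eqs_word_rcons in Bk *.
have [|j [-> Bj]] := boundary_cat _ (ltn0Sn k) Bk; first by rewrite all_cat /= !no_end_term.
rewrite drop_cat ltnNge leq_addr /= addKn => /(IH _ Bj) [t [v' [tG ->]]].
by exists t, v'; split=> //; right.
Qed.

Lemma boundary_of_equation G s t : List.In (s, t) G ->
  exists k v, boundary (eqs_word G) k /\
    drop k (eqs_word G) = tw s ++ eq_tok S :: tw t ++ v.
Proof.
elim: G => [|[p q] G IH] //= -[[-> ->]|/IH [k [v [Bk E]]]].
  by exists 0, (end_tok S :: eqs_word G); rewrite drop0 eqs_word_cons.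
exists (size (rcons (tw p ++ eq_tok S :: tw q) (end_tok S)) + k), v.
rewrite eqs_word_rcons /=; split; first exact: boundary_cat_r.
by rewrite drop_cat ltnNge leq_addr /= addKn.
Qed.

End EquationWord.

(** * The decision program *)

Lemma In_enum (T : finType) (x : T) : List.In x (enum T).
Proof.
have : x \in enum T by rewrite mem_enum.
by elim: (enum T) => //= y s IH; rewrite inE => /predU1P[->|/IH]; [left|right].
Qed.

Lemma In_map (A B : Type) (f : A -> B) (s : seq A) y :
  List.In y (map f s) -> exists2 x, List.In x s & y = f x.
Proof.
elim: s => //= x s IH [<-|/IH [x' ? ->]]; first by exists x; [left|].
by exists x'; [right|].
Qed.

Section Decision.
Variable S : signature.

(** The successor makes the bound at least 1, so that [spanR 1] is always a faithful name. *)
Definition arity_bound : nat := (\max_(f : S) arity f).+1.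
Notation M := arity_bound.

Lemma arity_le_bound (f : S) : arity f <= M.
Proof. exact/leqW/(@leq_bigmax _ (fun f : S => arity f)). Qed.

Definition rel_name : finType := (bool * 'I_M.+1 + unit)%type.
Definition spanR (m : nat) : rel_name := inl (true, inord m).
(* sameR m x y: the first m arguments at x and y are congruent. *)
Definition sameR (m : nat) : rel_name := inl (false, inord m).
Definition congR : rel_name := inr tt.

(** Tape 0 is the input and also the pointer [px]; 1 to 3 are auxiliary; 4 to 6 are the other rule
    variables; 7 and 8 count passes; those from 9 on hold the arguments in the totality test. *)
Notation nt := (8 + M).
Definition pt (k : nat) : 'I_nt.+1 := inord k.
Notation px := (pt 0).
Notation py := (pt 4).
Notation pu := (pt 5).
Notation pv := (pt 6).
Notation pa j := (pt (9 + j)).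

Lemma pt_eq k l : k <= nt -> l <= nt -> (pt k == pt l) = (k == l).
Proof. by move=> hk hl; rewrite -val_eqE /= !inordK. Qed.

Notation tok := (token S).
Notation cell := (cell tok (work_alphabet rel_name)).
Notation prog := (prog tok rel_name nt).
Notation store := (store rel_name).
Notation skip := (Skip tok rel_name nt).

Definition is_symbol (c : cell) : bool := if c is Some (inl (inl _)) then true else false.
Definition is_token (a : tok) (c : cell) : bool := c == Some (inl a).
Definition is_start (c : cell) : bool :=
  (c == mark tok rel_name) || is_token (end_tok S) c.

Definition look q i j : prog := Look tok q i false j false.
Definition look_next q i j : prog := Look tok q i true j false.
Definition mkrule (g : prog) q i j := Rule g q i false j false.

Definition rule_span0 := mkrule skip (spanR 0) px px.
(** Parsing without a stack: [m + 1] terms are a symbol [f], its [arity f] arguments up to [u], and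
    [m] further terms up to [y]. *)
Definition rule_spanS (fm : S * 'I_M) :=
  mkrule (conj [:: Test (is_token (sym_tok fm.1)) px;
                   look_next (spanR (arity fm.1)) px pu; look (spanR fm.2) pu py])
    (spanR fm.2.+1) px py.
Definition rule_refl := mkrule (Test is_symbol px) congR px px.
Definition rule_sym := mkrule (look congR py px) congR px py.
Definition rule_trans := mkrule (conj [:: look congR px py; look congR py pu]) congR px pu.
(** [py] stands on the equality mark, so the right-hand side begins one position later; hence the
    offset in the head. *)
Definition rule_equation :=
  Rule (conj [:: TestLeft is_start px; look (spanR 1) px py; Test (is_token (eq_tok S)) py])
    congR px false py true.
Definition rule_same0 := mkrule skip (sameR 0) px py.
(** Arguments are compared one at a time, so four pointers are enough whatever the arity. *)
Definition rule_sameS (j : 'I_M) :=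
  mkrule (conj [:: look (sameR j) px py; look_next (spanR j) px pu;
                   look_next (spanR j) py pv; look congR pu pv])
    (sameR j.+1) px py.
Definition rule_App (f : S) :=
  mkrule (conj [:: Test (is_token (sym_tok f)) px; Test (is_token (sym_tok f)) py;
                   look (sameR (arity f)) px py])
    congR px py.

Definition rules :=
  [:: rule_span0; rule_refl; rule_sym; rule_trans; rule_equation; rule_same0] ++
  map rule_spanS (enum {: S * 'I_M}) ++ map rule_sameS (enum 'I_M) ++ map rule_App (enum S).

Definition vars := [:: px; py; pu; pv].

Lemma rules_ind (P : rule tok rel_name nt -> Prop) :
  P rule_span0 -> (forall fm, P (rule_spanS fm)) -> P rule_refl -> P rule_sym ->
  P rule_trans -> P rule_equation -> P rule_same0 -> (forall j, P (rule_sameS j)) ->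
  (forall f, P (rule_App f)) -> forall r, List.In r rules -> P r.
Proof.
move=> P1 P2 P3 P4 P5 P6 P7 P8 P9 r.
do 6!(case=> [<- //|]); move=> H; case: (List.in_app_or _ _ _ H) => {}H; last first.
  by case: (List.in_app_or _ _ _ H) => {}H; have [i _ ->] := In_map H.
by have [i _ ->] := In_map H.
Qed.

Lemma rules_positive r : List.In r rules -> positive (guard r).
Proof. by move: r; apply: rules_ind. Qed.

Lemma In_spanS fm : List.In (rule_spanS fm) rules.
Proof. by do 6!right; apply/List.in_or_app; left; apply/List.in_map/In_enum. Qed.

Lemma In_sameS j : List.In (rule_sameS j) rules.
Proof.
by do 6!right; apply/List.in_or_app; right; apply/List.in_or_app; left; apply/List.in_map/In_enum.
Qed.

Lemma In_App f : List.In (rule_App f) rules.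
Proof.
by do 6!right; apply/List.in_or_app; right; apply/List.in_or_app; right; apply/List.in_map/In_enum.
Qed.

Notation well_scoped := (well_scoped (pt 1) (pt 2) (pt 3)).

Lemma well_scoped_conj D (ps : seq prog) :
  (forall p, List.In p ps -> well_scoped D p) -> well_scoped D (conj ps).
Proof.
elim: ps => //= p ps IH H; rewrite H /=; last by left.
by apply: IH => q ?; apply: H; right.
Qed.

Lemma aux_uniq : uniq [:: pt 1; pt 2; pt 3].
Proof. by rewrite /= !inE !pt_eq. Qed.

Lemma notin_aux k : 3 < k <= nt -> pt k \notin aux (pt 1) (pt 2) (pt 3).
Proof. by move=> /andP[k3 kn]; rewrite !inE !pt_eq // !negb_or; lia. Qed.

Lemma px_notin_aux : px \notin aux (pt 1) (pt 2) (pt 3).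
Proof. by rewrite !inE !pt_eq. Qed.

Lemma pass_scoped D : (forall i, i \in vars -> ~~ D i) -> well_scoped D (pass rules vars).
Proof.
move=> H.
have Hx : ~~ D px by apply: H; rewrite inE eqxx.
have Hy : ~~ D py by apply: H; rewrite !inE eqxx orbT.
have Hu : ~~ D pu by apply: H; rewrite !inE eqxx !orbT.
have Hv : ~~ D pv by apply: H; rewrite !inE eqxx !orbT.
have W (D' : 'I_nt.+1 -> bool) : D' px -> D' py -> D' pu -> D' pv -> well_scoped D' (fire_all rules).
  move=> Dx Dy Du Dv.
  apply: well_scoped_conj => p H1; have [r + ->] := In_map H1; move: r {H1}.
  by refine (rules_ind (P := fun r => well_scoped _ (fire r)) _ _ _ _ _ _ _ _ _) => *;
    rewrite /= ?Dx ?Dy ?Du ?Dv.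
rewrite /pass /vars; move: (fire_all rules) W => p W.
rewrite /= px_notin_aux !notin_aux // /busy !pt_eq //= Hx Hy Hu Hv /=.
by apply: W; rewrite /= !pt_eq.
Qed.

(** Existential quantifiers are negated universal ones, here over the position [pu] of argument [j]
    and in [has_value] over the occurrence [px]. *)
Definition covered (j : nat) : prog :=
  Neg (All pu (Neg (And (look_next (spanR j) px pu) (look congR pu (pa j))))).
Definition has_value (f : S) : prog :=
  Neg (All px (Neg (And (Test (is_token (sym_tok f)) px)
                        (conj [seq covered j | j <- iota 0 (arity f)])))).
Definition arg_tapes (f : S) := [seq pa j | j <- iota 0 (arity f)].
Definition check (f : S) : prog :=
  Alls (arg_tapes f)
    (Neg (And (conj [seq Test is_symbol (pa j) | j <- iota 0 (arity f)]) (Neg (has_value f)))).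
(** The 9 comes from [(n + 2) ^ 2 <= 9 * n ^ 2] for positive [n]: the passes are then at least as
    many as the possible facts. *)
Definition decider : prog :=
  And (iterated rules vars (pt 7) (pt 8) (9 * #|rel_name|))
    (conj [seq check f | f <- enum S]).

Lemma pa_bound (f : S) j : j < arity f -> 9 + j <= nt.
Proof. by move=> jf; have := leq_trans jf (arity_le_bound f); lia. Qed.

Lemma uniq_arg_tapes f : uniq (arg_tapes f).
Proof.
rewrite map_inj_in_uniq ?iota_uniq // => i j.
rewrite !mem_iota /= add0n => /pa_bound hi /pa_bound hj /eqP.
by rewrite pt_eq // => /eqP /addnI.
Qed.

Lemma pt_arg_tapes k f : k < 9 -> pt k \notin arg_tapes f.
Proof.
move=> k9; apply/mapP => -[j]; rewrite mem_iota /= add0n => /pa_bound hj /eqP.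
by rewrite pt_eq; lia.
Qed.

Lemma well_scoped_Alls s (D : 'I_nt.+1 -> bool) (p : prog) : uniq s ->
  (forall i, i \in s -> (i \notin aux (pt 1) (pt 2) (pt 3)) && ~~ D i) ->
  (forall D' : 'I_nt.+1 -> bool, (forall i, D' i = (i \in s) || D i) -> well_scoped D' p) ->
  well_scoped D (Alls s p).
Proof.
elim: s D => [|i s IH] D /=; first by move=> _ _; apply.
move=> /andP[is_ us] H W; have /andP[ia iD] := H i (mem_head _ _).
rewrite ia iD /=; apply: IH => // [j js|D' HD'].
  have /andP[-> jD] := H j (mem_behead (s := i :: s) js).
  by rewrite /busy negb_or jD andbT; apply: contraNneq is_ => <-.
by apply: W => j; rewrite HD' /busy inE orbA [(j \in s) || _]orbC.
Qed.

Lemma check_scoped f : well_scoped (fun=> false) (check f).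
Proof.
apply: well_scoped_Alls => [|i|D HD]; first exact: uniq_arg_tapes.
  case/mapP=> j; rewrite mem_iota /= add0n => /pa_bound jf ->.
  by rewrite notin_aux.
have Dx : D px = false by rewrite HD (negPf (pt_arg_tapes _ _)).
have Du : D pu = false by rewrite HD (negPf (pt_arg_tapes _ _)).
have Da j : j \in iota 0 (arity f) -> D (pa j) by move=> jf; rewrite HD orbF; apply: (map_f (fun j => pa j)).
rewrite /= px_notin_aux Dx /= /busy eqxx /=; apply/andP; split.
  by move: Da; elim: (iota _ _) => //= j r IH Da; rewrite Da ?mem_head //= IH // => i ir;
    rewrite Da ?inE ?ir ?orbT.
move: Da; elim: (iota _ _) => //= j r IH Da; rewrite IH; last first.
  by move=> i ir; rewrite Da ?inE ?ir ?orbT.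
by rewrite notin_aux // /busy Da ?mem_head // !eqxx !orbT [pu == px]pt_eq // Du.
Qed.

Lemma decider_scoped : well_scoped (fun=> false) decider.
Proof.
apply/andP; split.
  have In_nseq c (q p : prog) : List.In p (nseq c q) -> p = q by elim: c => //= c IH [].
  apply: well_scoped_conj => p /In_nseq ->.
  apply/and3P; split=> //; first exact: notin_aux.
  apply/and3P; split; [by rewrite /busy pt_eq|exact: notin_aux|].
  by apply: pass_scoped => i; rewrite !inE => /or4P[] /eqP ->; rewrite /busy !pt_eq.
by apply: well_scoped_conj => p H; have [f _ ->] := In_map H; apply: check_scoped.
Qed.

(** * Correctness of the decision program on a given list of equations *)

Section Word.
Variable G : seq (term S * term S).
Notation w := (eqs_word G).
Notation n := (size w).
Notation occ := (occ w).
Notation child := (child w).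
Notation spans := (spans w).
Notation sat := (holds w).
Implicit Types (X : store) (h : 'I_nt.+1 -> nat).

Lemma holds_look q i j h X : sat (look q i j) h X = X q (h i) (h j).
Proof. by rewrite /holds /= !addn0. Qed.

Lemma holds_look_next q i j h X : sat (look_next q i j) h X = X q (h i).+1 (h j).
Proof. by rewrite /holds /= addn0 addn1. Qed.

Lemma holds_token a i h X : 0 < h i ->
  sat (Test (is_token a) i) h X = (ohead (tail_at w (h i)) == Some a).
Proof. by move=> hi; rewrite /holds /= /is_token padded_tail_at. Qed.

Definition symbol_at (x : nat) : bool :=
  if ohead (tail_at w x) is Some (inl _) then true else false.

Lemma is_symbol_padded x : 0 < x ->
  is_symbol (padded rel_name w x) = symbol_at x.
Proof.
case: x => // x _; rewrite /symbol_at /padded /tail_at /=.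
by elim: (w) x => [|b v IH] [|x] //=; case: b.
Qed.

Lemma holds_symbol i h X : 0 < h i ->
  sat (Test is_symbol i) h X = symbol_at (h i).
Proof. exact: is_symbol_padded. Qed.

Lemma holds_start i h X : 0 < h i ->
  sat (TestLeft is_start i) h X = boundary w (h i).-1.
Proof.
move=> _; rewrite [LHS](_ : _ = is_start (padded rel_name w (h i).-1)) //.
rewrite /is_start /boundary /is_token; case: (h i).-1 => // x.
rewrite padded_tail_at // -[_ == mark _ _]negbK padded_mark.
by [].
Qed.

Lemma occ_symbol x (f : S) : 0 < x -> ohead (tail_at w x) = Some (sym_tok f) ->
  exists a : {ffun 'I_(arity f) -> term S}, occ x (App a).
Proof.
move=> x0; case E: (tail_at w x) => [|c v] //= [e]; rewrite e in E.
have [[g a] [v' E']] := drop_symbol E.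
have e' : g = f by move: E'; rewrite -/(tail_at w x) E term_wordE => -[].
by subst g; exists a; split=> //; exists v'.
Qed.

Lemma occ_head x (f : S) (a : {ffun 'I_(arity f) -> term S}) :
  occ x (App a) -> ohead (tail_at w x) = Some (sym_tok f).
Proof. by move=> [_ [v ->]]; rewrite term_wordE. Qed.

Lemma occ_is_symbol x : 0 < x -> symbol_at x <-> exists t, occ x t.
Proof.
move=> x0; rewrite /symbol_at; split=> [|[[f a] /occ_head -> //]].
by case E: (ohead _) => [[f|//]|//] _; have [a ?] := occ_symbol x0 E; exists (App a).
Qed.

Lemma spans_App x f (a : {ffun 'I_(arity f) -> term S}) y :
  occ x (App a) -> spans (arity f) x.+1 y -> spans 1 x y.
Proof.
move=> ox sp; have [v E] := occ_args ox.
have [-> _] := spans_tail_at sp (size_subterms a) E.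
by apply/(occ_spans _ ox); rewrite term_wordE /= addSnnS.
Qed.

Definition congruent (x y : nat) : Prop :=
  exists s t, [/\ occ x s, occ y t & eqv G s t].

Definition meaning (q : rel_name) (x y : nat) : Prop :=
  match q with
  | inl (true, m) => spans m x y
  | inl (false, m) => forall i, i < m ->
      exists u v, [/\ child x i u, child y i v & congruent u v]
  | inr tt => congruent x y
  end.

(** The bounds on positions leave finitely many facts, as the count of passes requires. *)
Definition sound_fact (q : rel_name) (x y : nat) : Prop :=
  [/\ x < n.+2, y < n.+2 & meaning q x y].

Lemma meaning_span m x y : m <= M -> meaning (spanR m) x y = spans m x y.
Proof. by move=> mM; rewrite /= inordK. Qed.

Lemma meaning_same m x y : m <= M -> meaning (sameR m) x y =
  forall i, i < m -> exists u v, [/\ child x i u, child y i v & congruent u v].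
Proof. by move=> mM; rewrite /= inordK. Qed.

Lemma congruent_refl x t : occ x t -> congruent x x.
Proof. by move=> ox; exists t, t; split=> //; apply: (congr_refl (eqv_congruence G)). Qed.

Lemma congruent_sym x y : congruent x y -> congruent y x.
Proof.
by move=> [s [t [? ? st]]]; exists t, s; split=> //; apply: (congr_sym (eqv_congruence G)).
Qed.

Lemma congruent_trans x y u : congruent x y -> congruent y u -> congruent x u.
Proof.
move=> [s [t [os ot st]]] [t' [r [ot' or tr]]]; exists s, r; split=> //.
by apply: (congr_trans (eqv_congruence G) st); rewrite (occ_inj ot ot').
Qed.

Lemma congruent_App x y f (a b : {ffun 'I_(arity f) -> term S}) :
  occ x (App a) -> occ y (App b) ->
  (forall i, i < arity f -> exists u v, [/\ child x i u, child y i v & congruent u v]) ->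
  congruent x y.
Proof.
move=> oa ob H; exists (App a), (App b); split=> //.
apply: (congr_App (eqv_congruence G)) => i.
have [u [v [cu cv [s [t [os ot st]]]]]] := H i (ltn_ord i).
by rewrite -(occ_inj os (child_occ oa cu)) -(occ_inj ot (child_occ ob cv)).
Qed.

Lemma upds_vars x y u v (h := upds (fun=> 0) vars [:: x; y; u; v]) :
  [/\ h px = x, h py = y, h pu = u & h pv = v].
Proof. by rewrite /h /= /upd !pt_eq. Qed.

Lemma rules_sound r ks X :
  List.In r rules -> size ks = size vars -> in_word w ks -> substore X sound_fact ->
  sat (guard r) (upds (fun=> 0) vars ks) X ->
  head_in r (upds (fun=> 0) vars ks) sound_fact.
Proof.
move=> + sk + XC; case: ks sk => [|x [|y [|u [|v []]]]] //= _.
rewrite andbT => + /and4P[xn yn un vn]; rewrite -[upd _ pv v]/(upds (fun=> 0) vars [:: x; y; u; v]).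
have [hx hy hu hv] := upds_vars x y u v; move: hx hy hu hv.
move: (upds _ _ _) => h hx hy hu hv; have hE := (hx, hy, hu, hv); move: xn yn un vn.
move=> /andP[x0 xn] /andP[y0 yn] /andP[u0 un] /andP[v0 vn].
have le2 z : z <= n -> z < n.+2 by move=> zn; rewrite ltnS leqW.
have XM q z z' : X q z z' -> meaning q z z' by move=> /XC [].
move: r; apply: rules_ind; rewrite /head_in.
- move=> _ /=; rewrite !addn0 ?hE; split; try exact: le2.
  by rewrite meaning_span //; apply: spans0.
- move=> [f m]; rewrite holds_conj //= !holds_look_next !holds_look !holds_token ?hE //.
  rewrite !addn0 ?hE andbT => /and3P[/eqP fx /XM sf /XM sm].
  have [a ox] := occ_symbol x0 fx.
  split; try exact: le2; rewrite meaning_span //.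
  move: sf sm; rewrite !meaning_span ?arity_le_bound 1?ltnW // => sf.
  by apply: spans_cat (spans_App ox sf).
- rewrite holds_symbol ?hE // => sx.
  have [t ox] := proj1 (occ_is_symbol x0) sx; rewrite /= !addn0 ?hE.
  by split; try exact: le2; apply: congruent_refl ox.
- rewrite holds_look ?hE => /XM /congruent_sym; rewrite /= !addn0 ?hE.
  by split; try exact: le2.
- rewrite holds_conj //= !holds_look ?hE andbT => /andP[/XM xy /XM yu].
  by rewrite !addn0 ?hE; split; try exact: le2; apply: congruent_trans yu.
- rewrite holds_conj //= holds_look holds_token ?holds_start ?hE // andbT addn0 addn1 ?hE.
  move=> /and3P[Bx /XM sp /eqP ey].
  move: sp; rewrite meaning_span // => /spans1_occ [s [os yE]].
  have [_ [v1 Ev]] := os.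
  have Ey : tail_at w y = v1 by rewrite yE (tail_at_add x0 Ev).
  case: v1 Ev Ey => [|c v1] Ev Ey; first by rewrite Ey in ey.
  move: ey; rewrite Ey => -[ec]; subst c.
  (* A term that starts at a boundary and is followed by the equality mark is, by unique
     readability, a whole left-hand side. *)
  have [t [v2 [stG Ev2]]] := equation_at_boundary Bx Ev.
  split; [exact: le2|by rewrite !ltnS|]; exists s, t; split=> //.
    split=> //; exists v2; rewrite -addn1 -Ev2.
    exact: (tail_at_add (v := [:: eq_tok S]) y0 Ey erefl).
  by move=> r rC rG; apply: rG.
- move=> _ /=; rewrite !addn0 ?hE; split; try exact: le2.
  by rewrite meaning_same.
- move=> j; rewrite holds_conj //= !holds_look_next !holds_look !addn0 ?hE andbT.
  move=> /and4P[/XM same /XM cu /XM cv /XM uv].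
  split; try exact: le2; rewrite meaning_same // => i.
  have jM : j <= M by apply: ltnW.
  move: same cu cv; rewrite meaning_same // !meaning_span // => same cu cv.
  by rewrite ltnS leq_eqVlt => /predU1P[->|/same //]; exists u, v.
- move=> f; rewrite holds_conj //= !holds_look !holds_token ?hE // !addn0 ?hE andbT.
  move=> /and3P[/eqP fx /eqP fy /XM same].
  have [a ox] := occ_symbol x0 fx; have [b oy] := occ_symbol y0 fy.
  split; try exact: le2; apply: congruent_App ox oy _.
  by move: same; rewrite meaning_same // arity_le_bound.
Qed.

(** * Sound tables that are closed under the rules *)

Section Saturated.
Variable X : store.
Hypothesis saturated_sound : substore X sound_fact.
Hypothesis saturated_closed : forall r ks, List.In r rules -> size ks = size vars -> in_word w ks ->
  let h := upds (fun=> 0) vars ks in sat (guard r) h X -> head_in r h X.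

Lemma saturated_meaning q x y : X q x y -> meaning q x y.
Proof. by case/saturated_sound. Qed.

Lemma saturated_derives r x y u v : List.In r rules -> in_word w [:: x; y; u; v] ->
  (forall h, h px = x -> h py = y -> h pu = u -> h pv = v -> sat (guard r) h X) ->
  exists h, [/\ h px = x, h py = y, h pu = u, h pv = v & head_in r h X].
Proof.
move=> rin ksn H; have [hx hy hu hv] := upds_vars x y u v.
by eexists; split; [exact: hx|exact: hy|exact: hu|exact: hv|]; apply: saturated_closed => //; apply: H.
Qed.

Lemma saturated_span0 x : 0 < x <= n -> X (spanR 0) x x.
Proof.
move=> xn; have [||//|h [hx _ _ _]] := @saturated_derives rule_span0 x x x x.
- by left.
- by rewrite /in_word /= xn.
by rewrite /head_in /= !addn0 hx.
Qed.

Lemma saturated_spanS f m x u y : m < M -> 0 < x <= n -> 0 < u <= n -> 0 < y <= n ->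
  ohead (tail_at w x) = Some (sym_tok f) -> X (spanR (arity f)) x.+1 u ->
  X (spanR m) u y -> X (spanR m.+1) x y.
Proof.
move=> mM xn un yn fx Xf Xm.
have [||h hx hy hu _|h [hx hy _ _]] := @saturated_derives (rule_spanS (f, Ordinal mM)) x y u x.
- exact: In_spanS.
- by rewrite /in_word /= xn yn un.
- rewrite holds_conj //= holds_look_next holds_look holds_token hx ?hy ?hu.
    by rewrite fx eqxx Xf Xm.
  by case/andP: xn.
by rewrite /head_in /= !addn0 hx hy.
Qed.

Lemma saturated_refl x t : occ x t -> X congR x x.
Proof.
move=> ox; have xn := occ_le ox; have [x0 _] := ox.
have [||h hx _ _ _|h [hx _ _ _]] := @saturated_derives rule_refl x x x x.
- by do 1!right; left.
- by rewrite /in_word /= xn.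
- by rewrite holds_symbol hx //; apply/occ_is_symbol => //; exists t.
by rewrite /head_in /= !addn0 hx.
Qed.

Lemma saturated_range x y : X congR x y -> (0 < x <= n) /\ (0 < y <= n).
Proof. by move=> /saturated_meaning [s [t [/occ_le ? /occ_le ? _]]]. Qed.

Lemma saturated_sym x y : X congR x y -> X congR y x.
Proof.
move=> Xxy; have [xn yn] := saturated_range Xxy.
have [||h hx hy _ _|h [hx hy _ _]] := @saturated_derives rule_sym y x x x.
- by do 2!right; left.
- by rewrite /in_word /= xn yn.
- by rewrite holds_look hx hy.
by rewrite /head_in /= !addn0 hx hy.
Qed.

Lemma saturated_trans x y u : X congR x y -> X congR y u -> X congR x u.
Proof.
move=> Xxy Xyu; have [xn yn] := saturated_range Xxy; have [_ un] := saturated_range Xyu.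
have [||h hx hy hu _|h [hx _ hu _]] := @saturated_derives rule_trans x y u x.
- by do 3!right; left.
- by rewrite /in_word /= xn yn un.
- by rewrite holds_conj //= !holds_look hx hy hu Xxy Xyu.
by rewrite /head_in /= !addn0 hx hu.
Qed.

Lemma saturated_equation x y : 0 < x <= n -> 0 < y <= n -> boundary w x.-1 ->
  X (spanR 1) x y -> ohead (tail_at w y) = Some (eq_tok S) -> X congR x y.+1.
Proof.
move=> xn yn Bx Xxy ey; have [x0 _] := andP xn; have [y0 _] := andP yn.
have [||h hx hy _ _|h [hx hy _ _]] := @saturated_derives rule_equation x y x x.
- by do 4!right; left.
- by rewrite /in_word /= xn yn.
- by rewrite holds_conj //= holds_look holds_token ?holds_start ?hx ?hy // Bx Xxy ey eqxx.
by rewrite /head_in /= addn0 addn1 hx hy.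
Qed.

Lemma saturated_same0 x y : 0 < x <= n -> 0 < y <= n -> X (sameR 0) x y.
Proof.
move=> xn yn; have [||//|h [hx hy _ _]] := @saturated_derives rule_same0 x y x x.
- by do 5!right; left.
- by rewrite /in_word /= xn yn.
by rewrite /head_in /= !addn0 hx hy.
Qed.

Lemma saturated_sameS j x y u v : j < M -> in_word w [:: x; y; u; v] -> X (sameR j) x y ->
  X (spanR j) x.+1 u -> X (spanR j) y.+1 v -> X congR u v -> X (sameR j.+1) x y.
Proof.
move=> jM ksn Xj Xu Xv Xuv.
have [|//|h hx hy hu hv|h [hx hy _ _]] := @saturated_derives (rule_sameS (Ordinal jM)) x y u v.
- exact: In_sameS.
- by rewrite holds_conj //= !holds_look_next !holds_look hx hy hu hv Xj Xu Xv Xuv.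
by rewrite /head_in /= !addn0 hx hy.
Qed.

Lemma saturated_same_congR f x y : 0 < x <= n -> 0 < y <= n ->
  ohead (tail_at w x) = Some (sym_tok f) -> ohead (tail_at w y) = Some (sym_tok f) ->
  X (sameR (arity f)) x y -> X congR x y.
Proof.
move=> xn yn fx fy Xf; have [x0 _] := andP xn; have [y0 _] := andP yn.
have [||h hx hy _ _|h [hx hy _ _]] := @saturated_derives (rule_App f) x y x x.
- exact: In_App.
- by rewrite /in_word /= xn yn.
- by rewrite holds_conj //= holds_look !holds_token ?hx ?hy // fx fy !eqxx Xf.
by rewrite /head_in /= !addn0 hx hy.
Qed.

(** Strong induction on the length of the block: the arguments of its first term and the terms after
    that one are both shorter blocks. The bound on [y] is the range of the pointers; it holds where
    this is used, as an argument or an equality mark stands at [y]. *)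
Lemma saturated_spans m x y : m <= M -> y <= n -> spans m x y -> X (spanR m) x y.
Proof.
move=> mM yn [x0 [l [v [lm Ex ey]]]].
elim: {l}(size (forest_word l)).+1 {-2}l (ltnSn (size (forest_word l))) m x y v mM yn x0 lm Ex ey
  => // k IH l; rewrite ltnS => lk m x y v mM yn x0 lm Ex ey.
case: l lk lm Ex ey => [|[f a] l] lk lm Ex ey.
  by rewrite -lm ey addn0 saturated_span0 // x0; move: yn; rewrite ey addn0.
set t := App a in lk lm Ex ey; set u := x + size (term_word t).
have Ex' : tail_at w x = term_word t ++ (forest_word l ++ v) by rewrite Ex forest_word_cons catA.
have Eu : tail_at w u = forest_word l ++ v by apply: tail_at_add Ex' _.
have eyu : y = u + size (forest_word l) by rewrite ey forest_word_cons size_cat addnA.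
have un : u <= n by apply: leq_trans yn; rewrite eyu leq_addr.
have xu : x < u by rewrite /u /t term_wordE /= -[x.+1]addn1 leq_add.
have ox : occ x t by split=> //; exists (forest_word l ++ v).
have [v' Es] := occ_args ox.
have tk : size (forest_word (subterms a)) < size (term_word t) by rewrite /t term_wordE.
move: lk; rewrite forest_word_cons size_cat => lk.
rewrite -lm /=; apply: (@saturated_spanS f _ x u).
- by rewrite -ltnS; move: mM; rewrite -lm.
- by rewrite x0 (leq_trans (ltnW xu)).
- by rewrite un (leq_trans _ xu).
- by rewrite yn eyu addn_gt0 (leq_trans _ xu).
- exact: occ_head ox.
- apply: (IH (subterms a) _ _ _ _ v') => //.
  + by apply: leq_trans lk; apply: leq_trans tk (leq_addr _ _).
  + exact: arity_le_bound.
  + by rewrite size_subterms.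
  + by rewrite /u /t term_wordE /= addSnnS.
- apply: (IH l _ _ _ _ v) => //.
  + apply: leq_trans lk; rewrite -[X in X < _]add0n ltn_add2r.
    by rewrite /t term_wordE.
  + by move: mM; rewrite -lm; apply: ltnW.
  + by rewrite (leq_trans _ xu).
Qed.

Lemma saturated_App x y f (a b : {ffun 'I_(arity f) -> term S}) :
  occ x (App a) -> occ y (App b) ->
  (forall i : 'I_(arity f), exists u v, [/\ child x i u, child y i v & X congR u v]) ->
  X congR x y.
Proof.
move=> oa ob H; have xn := occ_le oa; have yn := occ_le ob.
apply: (saturated_same_congR xn yn (occ_head oa) (occ_head ob)).
have: arity f <= arity f by [].
(* The number [j] of arguments compared grows up to the arity, which itself stays fixed. *)
move: {1 3}(arity f) => j; elim: j => [|j IH] jf; first exact: saturated_same0.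
have [u [v [cu cv Xuv]]] := H (Ordinal jf).
have [un vn] := saturated_range Xuv; have jM := leq_trans jf (arity_le_bound f).
apply: (saturated_sameS (u := u) (v := v)) (IH (ltnW jf)) _ _ Xuv => //.
- by rewrite /in_word /= xn yn un vn.
- by apply: saturated_spans cu; [exact: ltnW|case/andP: un].
- by apply: saturated_spans cv; [exact: ltnW|case/andP: vn].
Qed.

Lemma saturated_eqs s t : List.In (s, t) G -> exists x y, [/\ occ x s, occ y t & X congR x y].
Proof.
move=> /boundary_of_equation [k [v [Bk Ek]]].
have os : occ k.+1 s by split=> //; exists (eq_tok S :: term_word t ++ v).
set y := k.+1 + size (term_word s).
have Ey : tail_at w y = eq_tok S :: term_word t ++ v by apply: (tail_at_add (x := k.+1) isT Ek erefl).
have yn : y <= n by apply: tail_at_le Ey.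
exists k.+1, y.+1; split=> //.
  split=> //; exists v; rewrite -addn1.
  by apply: (tail_at_add (v := [:: eq_tok S]) _ Ey erefl).
apply: saturated_equation => //; first exact: occ_le os.
  by apply: saturated_spans => //; apply/(occ_spans _ os).
by rewrite Ey.
Qed.

Lemma saturated_finite (g : S) : 0 < arity g ->
  finite_set (quotient_carrier G) <-> closed_nodes occ child (fun x y => X congR x y).
Proof.
move=> g0.
have Ksound x y : X congR x y -> exists s t, [/\ occ x s, occ y t & eqv G s t].
  exact: saturated_meaning.
split.
  exact: (finite_quotient_closed (@child_ex S w) (@child_occ S w)
    saturated_refl saturated_sym saturated_trans saturated_eqs saturated_App g0).
apply: (closed_finite_quotient (D := `I_n.+1) (@occ_inj S w) (@child_ex S w) (@child_occ S w)
    Ksound saturated_refl saturated_sym saturated_trans saturated_eqs saturated_App); first exact: finite_II.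
by move=> x t /occ_le /andP[_].
Qed.

Lemma upds_out h s ks i : i \notin s -> upds h s ks i = h i.
Proof.
elim: s ks h => [|j s IH] [|k ks] h //=; rewrite inE negb_or => /andP[ij si].
by rewrite IH // /upd (negPf ij).
Qed.

Lemma upds_nth h s ks i0 j : uniq s -> size ks = size s -> j < size s ->
  upds h s ks (nth i0 s j) = nth 0 ks j.
Proof.
elim: s ks h j => [|i s IH] [|k ks] h [|j] //= /andP[si us] [E].
  by rewrite upds_out // /upd eqxx.
by move=> jn; rewrite IH.
Qed.

Lemma upds_args h (f : S) ks j : size ks = arity f -> j < arity f ->
  upds h (arg_tapes f) ks (pa j) = nth 0 ks j.
Proof.
move=> sk jf; have sz : size (arg_tapes f) = arity f by rewrite size_map size_iota.
rewrite -(upds_nth h px (uniq_arg_tapes f)) ?sz //.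
by rewrite (nth_map 0) ?size_iota // nth_iota.
Qed.

Lemma holds_covered (f : S) j h : j < arity f ->
  sat (covered j) h X <->
  exists2 u, 0 < u <= n & X (spanR j) (h px).+1 u /\ X congR u (h (pa j)).
Proof.
move=> jf; have jn := pa_bound jf; rewrite holds_Neg.
have E u : sat (And (look_next (spanR j) px pu) (look congR pu (pa j))) (upd h pu u) X =
    X (spanR j) (h px).+1 u && X congR u (h (pa j)).
  by rewrite holds_And // holds_look_next holds_look /upd !pt_eq.
split=> [/holds_AllP-/(_ isT) H|[u un [X1 X2]]].
  apply: contrapT => H'; apply: H => u un; rewrite holds_Neg E; apply/negP => /andP[X1 X2].
  by apply: H'; exists u.
apply/negP => /holds_AllP-/(_ isT u un); rewrite holds_Neg E.
by rewrite X1 X2.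
Qed.

Lemma holds_has_value (f : S) h : sat (has_value f) h X <->
  exists2 x, 0 < x <= n & ohead (tail_at w x) = Some (sym_tok f) /\
    forall j, j < arity f ->
      exists2 u, 0 < u <= n & X (spanR j) x.+1 u /\ X congR u (h (pa j)).
Proof.
have pc : all (@pure _ _ _) [seq covered j | j <- iota 0 (arity f)] by rewrite all_map; apply/allP.
have pc' := pc; rewrite -pure_conj in pc'.
have E x : 0 < x -> sat (And (Test (is_token (sym_tok f)) px)
      (conj [seq covered j | j <- iota 0 (arity f)])) (upd h px x) X <->
    ohead (tail_at w x) = Some (sym_tok f) /\ forall j, j < arity f ->
      exists2 u, 0 < u <= n & X (spanR j) x.+1 u /\ X congR u (h (pa j)).
  move=> x0; have hx : upd h px x px = x by rewrite /upd eqxx.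
  rewrite holds_And // holds_conj // holds_token hx // all_map.
  have ha j : j < arity f -> upd h px x (pa j) = h (pa j).
    by move=> /pa_bound jn; rewrite /upd pt_eq.
  split=> [/andP[/eqP fx /allP H]|[-> H]].
    split=> // j jf; have := H j; rewrite mem_iota /= add0n => /(_ jf) /(holds_covered _ jf).
    by rewrite hx ha.
  rewrite eqxx; apply/allP => j; rewrite mem_iota /= add0n => jf.
  by apply/(holds_covered _ jf); rewrite hx ha //; apply: H.
have pA : pure (Neg (And (Test (is_token (sym_tok f)) px)
      (conj [seq covered j | j <- iota 0 (arity f)]))) by [].
rewrite holds_Neg; split=> [/holds_AllP-/(_ pA) H|[x xn H]].
  apply: contrapT => H'; apply: H => x xn; rewrite holds_Neg; apply/negP => /E H2.
  by apply: H'; exists x => //; apply: H2; case/andP: xn.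
apply/negP => /holds_AllP-/(_ pA x xn); rewrite holds_Neg => /negP; apply.
by apply/E => //; case/andP: xn.
Qed.

Lemma holds_check (f : S) h : sat (check f) h X <->
  forall ks, size ks = arity f -> in_word w ks ->
    (forall j, j < arity f -> symbol_at (nth 0 ks j)) ->
    exists2 x, 0 < x <= n & ohead (tail_at w x) = Some (sym_tok f) /\
      forall j, j < arity f ->
        exists2 u, 0 < u <= n & X (spanR j) x.+1 u /\ X congR u (nth 0 ks j).
Proof.
have sz : size (arg_tapes f) = arity f by rewrite size_map size_iota.
have pt : all (@pure _ _ _) [seq Test is_symbol (pa j) : prog | j <- iota 0 (arity f)].
  by rewrite all_map; apply/allP.
have pt' := pt; rewrite -pure_conj in pt'.
have pv : pure (has_value f).
  by rewrite /= pure_conj all_map; apply/allP.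
have pc : pure (Neg (And (conj [seq Test is_symbol (pa j) : prog | j <- iota 0 (arity f)])
    (Neg (has_value f)))) by rewrite /= -/(has_value f) pt'.
have E ks : size ks = arity f -> in_word w ks ->
    sat (conj [seq Test is_symbol (pa j) : prog | j <- iota 0 (arity f)])
      (upds h (arg_tapes f) ks) X <-> forall j, j < arity f -> symbol_at (nth 0 ks j).
  move=> sk ksn; rewrite holds_conj // all_map.
  have S1 j : j < arity f -> sat (Test is_symbol (pa j)) (upds h (arg_tapes f) ks) X =
      symbol_at (nth 0 ks j).
    move=> jf; rewrite holds_symbol upds_args //.
    by move/all_nthP: ksn => /(_ 0 j); rewrite sk => /(_ jf) /andP[].
  split=> [/allP H j jf|H]; first by rewrite -S1 //; apply: H; rewrite mem_iota.
  by apply/allP => j; rewrite mem_iota /= add0n => jf; rewrite S1 // H.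
have V ks : size ks = arity f -> sat (has_value f) (upds h (arg_tapes f) ks) X <->
    exists2 x, 0 < x <= n & ohead (tail_at w x) = Some (sym_tok f) /\
      forall j, j < arity f ->
        exists2 u, 0 < u <= n & X (spanR j) x.+1 u /\ X congR u (nth 0 ks j).
  move=> sk; split=> [/holds_has_value [x xn [fx H]]|[x xn [fx H]]].
    by exists x => //; split=> // j jf; have := H j jf; rewrite upds_args.
  by apply/holds_has_value; exists x => //; split=> // j jf; rewrite upds_args //; apply: H.
rewrite /check; split=> [/holds_AllsP-/(_ pc) H ks sk ksn sy|H].
  apply/(V _ sk); have := H ks; rewrite sz => /(_ sk ksn).
  rewrite holds_Neg holds_And // holds_Neg negb_and negbK => /orP[/negP[]|//].
  exact/E.
apply/holds_AllsP => // ks; rewrite sz => sk ksn.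
rewrite holds_Neg holds_And // holds_Neg negb_and negbK.
case: (boolP (sat _ _ _)) => //= /(E _ sk ksn) sy.
by apply/V => //; apply: H.
Qed.

(** The positions carrying a symbol are exactly the occurrences, so loops over positions filtered by
    [is_symbol] range over all tuples of nodes. *)
Lemma holds_checks h :
  sat (conj [seq check f | f <- enum S]) h X <-> closed_nodes occ child (fun x y => X congR x y).
Proof.
have pc f : pure (check f).
  rewrite /check pure_Alls /= !pure_conj; apply/andP.
  by split; rewrite all_map; apply/allP.
rewrite holds_conj; last by rewrite all_map; apply/allP => f _; apply: pc.
rewrite all_map; split=> [/allP H f x ox|H]; last first.
  apply/allP => f _; apply/holds_check => ks sk ksn sy.
  have [|y [b [oy Hy]]] := H f (fun i => nth 0 ks i).
    move=> i; apply/occ_is_symbol; last exact: sy.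
    by move/all_nthP: ksn => /(_ 0 i); rewrite sk => /(_ (ltn_ord i)) /andP[].
  exists y; first exact: occ_le oy.
  split=> [|j jf]; first exact: occ_head oy.
  have [u cu Xu] := Hy (Ordinal jf); have [un _] := saturated_range Xu.
  exists u => //; split=> //; apply: saturated_spans cu; last by case/andP: un.
  by apply: ltnW; apply: leq_trans jf (arity_le_bound f).
have Hf : sat (check f) h X by apply: H; rewrite mem_enum.
pose ks := [seq x i | i <- enum 'I_(arity f)].
have sk : size ks = arity f by rewrite size_map size_enum_ord.
have nthE (i : 'I_(arity f)) : nth 0 ks i = x i.
  by rewrite (nth_map i) ?size_enum_ord // nth_ord_enum.
have xin i : 0 < x i <= n by have [t /occ_le] := ox i.
have [||y yn [fy Hy]] := proj1 (holds_check f h) Hf ks sk.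
- by apply/allP => _ /mapP[i _ ->].
- move=> j jf; rewrite (nthE (Ordinal jf)); apply/occ_is_symbol; last exact: ox.
  by case/andP: (xin (Ordinal jf)).
have [|b oy] := occ_symbol _ fy; first by case/andP: yn.
exists y, b; split=> // i; have [u un [X1 X2]] := Hy i (ltn_ord i).
exists u; last by rewrite -nthE.
by move: (saturated_meaning X1); rewrite meaning_span // ltnW // (leq_trans (ltn_ord i)) ?arity_le_bound.
Qed.

End Saturated.

Notation no_facts := (fun (_ : rel_name) (_ _ : nat) => false).

Theorem decider_correct (g : S) : 0 < arity g ->
  (eval w decider (fun=> 0) no_facts).1 <-> finite_set (quotient_carrier G).
Proof.
move=> g0.
have PS : well_scoped (fun=> false) (pass rules vars) by apply: pass_scoped.
set step := fun X => (eval w (pass rules vars) (fun=> 0) X).2.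
set N := (9 * #|rel_name|) * (n * n); pose X := iter N step no_facts.
have E : (eval w decider (fun=> 0) no_facts).1 =
    sat (conj [seq check f | f <- enum S]) (fun=> 0) X.
  rewrite [LHS](_ : _ = (if (eval w (iterated rules vars (pt 7) (pt 8) (9 * #|rel_name|))
      (fun=> 0) no_facts).1 then eval w (conj [seq check f | f <- enum S]) (fun=> 0)
      (eval w (iterated rules vars (pt 7) (pt 8) (9 * #|rel_name|)) (fun=> 0) no_facts).2
      else (false, (eval w (iterated rules vars (pt 7) (pt 8) (9 * #|rel_name|))
      (fun=> 0) no_facts).2)).1) //.
  by rewrite (eval_iterated w rules_positive PS).
have P : preserves w sound_fact (pass rules vars) (fun=> 0).
  apply: (preserves_pass rules_positive) => r ks Y rin sk ksn YC gd.
  exact: rules_sound YC gd.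
have saturated_sound : substore X sound_fact.
  by rewrite /X; elim: N {X E} => //= k IH; apply: P.
have saturated_closed r ks : List.In r rules -> size ks = size vars -> in_word w ks ->
    let h := upds (fun=> 0) vars ks in sat (guard r) h X -> head_in r h X.
  move=> rin sk ksn; apply: (iter_pass_closed rules_positive) => //.
  apply: (iter_pass_stable rules_positive P) => //; first by move=> q x y [].
  (* A rule instance supplies a position, so the word is not empty, as the bound with the factor 9
     needs; on the empty word there is nothing to close. *)
  have n0 : 0 < n by case: ks sk ksn => //= x ks _ /andP[/andP[x0 xn] _]; apply: leq_trans xn.
  rewrite /N [9 * _]mulnC -mulnA leq_mul2l; apply/orP; right.
  by move: n0; case: n => // k _; nia.
rewrite E (holds_checks saturated_sound saturated_closed); apply: iff_sym.
exact: saturated_finite g0.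
Qed.

End Word.
End Decision.

(** Without arguments a term is just its head symbol, so the finitely many symbols index the
    classes. *)
Lemma finite_quotient_constants (S : signature) (G : seq (term S * term S)) :
  (forall f : S, arity f = 0) -> finite_set (quotient_carrier G).
Proof.
move=> a0; pose F (f : S) : set (term S) := [set u | exists2 t, head_symbol t = f & eqv G t u]%classic.
apply: (sub_finite_set (B := range F)); last exact/finite_image/finite_finset.
move=> _ [t _ <-]; exists (head_symbol t) => //.
apply/seteqP; split=> u; last by exists t.
move=> [[f a] + au]; case: t => g b /= e; subst g.
rewrite (_ : b = a) //; apply/ffunP => i.
by exfalso; case: i => i; rewrite a0.
Qed.

Theorem corollary3p11 (S : signature) :
  polytime_decidable (@eqs_word S) (@eqs_size S)
    (fun G : seq (term S * term S) => finite_set (quotient_carrier G)).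
Proof.
have [[g g0]|/forallNP H] := pselect (exists g : S, 0 < arity g).
  apply: (prog_polytime (aux_uniq S) (decider_scoped S)) => [G|G].
    exact: size_eqs_word.
  exact: decider_correct g0.
(* Only constants remain: the quotient is always finite, and the program that accepts every input
   decides the problem. *)
apply: (prog_polytime (p := Skip _ (rel_name S) _) (aux_uniq S)) => // G; first exact: size_eqs_word.
split=> // _; apply: finite_quotient_constants => f.
by have /negP := H f; rewrite -eqn0Ngt => /eqP.
Qed.
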